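(* Given any $\rho$ with $0<\rho\le1$, there exist sequences $(a_k)_{k\in\mathbb{N}}$ and $(m_k)_{k\in\mathbb{N}}$ with $a_k>0$ and $m_k\in\mathbb{N}$ for $k\in\mathbb{N}$ such that $$f(z)=\prod_{k=1}^\infty\left(1-\frac{z}{a_k}\right)^{m_k}$$ is a transcendental entire function of order $\rho$ and genus $0$, and there exists $r>0$ such that $m^n(r)\to\infty$ as $n\to\infty$.
   Context: $\mathbb{N}=\{1,2,\ldots\}$. For a transcendental entire function $f$, $M(r)=\max\{|f(z)|:|z|=r\}$, $m(r)=\min\{|f(z)|:|z|=r\}$ (with $m(0)=|f(0)|$), and $m^n$ denotes the $n$th iterate of the function $r\mapsto m(r)$ (the multiplicities $m_k$ are unrelated to this function). The order of $f$ is $\limsup_{r\to\infty}\frac{\log\log M(r)}{\log r}$. Genus: every finite order entire function has a Hadamard representation $f(z)=z^n e^{Q(z)}\prod_{k}E(z/b_k,p)$, where $n\ge0$ is an integer, $Q$ is a polynomial, the $b_k$ are the non-zero zeros of $f$ (repeated according to multiplicity), $E(z,0)=1-z$, $E(z,p)=(1-z)e^{z+z^2/2+\cdots+z^p/p}$ for $p\ge1$, and $p$ is the smallest non-negative integer for which $\sum_k|b_k|^{-(p+1)}$ converges. The genus of $f$ is $\max\{p,\deg Q\}$. *)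

(* Defs.v *)
From Stdlib Require Import Reals List Arith.
From Coquelicot Require Import Coquelicot.

Open Scope R_scope.

Definition entire (f : C -> C) : Prop :=
  forall z : C, ex_derive (K := C_AbsRing) (V := C_NormedModule) f z.

Definition Cpoly (c : nat -> C) (d : nat) (z : C) : C :=
  sum_n (fun k : nat => (c k * z ^ k)%C) d.

Definition is_polynomial (f : C -> C) : Prop :=
  exists (c : nat -> C) (d : nat), forall z : C, f z = Cpoly c d z.

Definition transcendental_entire (f : C -> C) : Prop :=
  entire f /\ ~ is_polynomial f.

(* For continuous f and 0 <= r the supremum and the infimum below are
   attained, so they are the maximum and the minimum of |f| on |z| = r.
   For r < 0 the circle is empty and both functions take the value 0. *)
Definition circle_values (f : C -> C) (r x : R) : Prop :=
  exists z : C, Cmod z = r /\ x = Cmod (f z).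

Definition max_modulus (f : C -> C) (r : R) : R :=
  real (Lub_Rbar (circle_values f r)).

Definition min_modulus (f : C -> C) (r : R) : R :=
  real (Glb_Rbar (circle_values f r)).

(* Coquelicot's is_LimSup_seq, with a real variable tending to +oo. *)
Definition is_LimSup_p_infty (h : R -> R) (l : Rbar) : Prop :=
  match l with
  | Finite l =>
      forall eps : posreal,
        (forall A : R, exists r : R, A <= r /\ l - eps < h r) /\
        (exists A : R, forall r : R, A <= r -> h r < l + eps)
  | p_infty => forall B A : R, exists r : R, A <= r /\ B < h r
  | m_infty => forall B : R, exists A : R, forall r : R, A <= r -> h r < B
  end.

Definition is_order (f : C -> C) (rho : Rbar) : Prop :=
  is_LimSup_p_infty (fun r : R => ln (ln (max_modulus f r)) / ln r) rho.

Fixpoint Cprod (u : nat -> C) (n : nat) : C :=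
  match n with
  | O => RtoC 1
  | S n => (Cprod u n * u n)%C
  end.

(* Convergence of an infinite product in the strict sense: after finitely many
   factors are removed, the partial products have a nonzero limit. *)
Definition is_infprod (u : nat -> C) (l : C) : Prop :=
  exists (N : nat) (p : C),
    p <> RtoC 0 /\
    filterlim (Cprod (fun k : nat => u (N + k)%nat)) eventually (locally p) /\
    l = (Cprod u N * p)%C.

Definition Cexp (z : C) : C :=
  (exp (Re z) * cos (Im z), exp (Re z) * sin (Im z)).

Definition weierstrass_factor (z : C) (p : nat) : C :=
  ((1 - z) * Cexp (sum_n_m (fun j : nat => (z ^ j / RtoC (INR j))%C) 1 p))%C.

(* mu = 0 means that w is not a zero of f. *)
Definition zero_multiplicity (f : C -> C) (w : C) (mu : nat) : Prop :=
  exists g : C -> C,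
    entire g /\ g w <> RtoC 0 /\ forall z : C, f z = ((z - w) ^ mu * g z)%C.

(* The nonzero zeros of f may be finite in number, so they are enumerated by
   nat -> option C: an index k with b k = None carries no zero.  The last clause
   says that each w <> 0 occurs as often as its multiplicity. *)
Definition enumerates_nonzero_zeros (f : C -> C) (b : nat -> option C) : Prop :=
  (forall k : nat, b k <> Some (RtoC 0)) /\
  (forall w : C, w <> RtoC 0 ->
     exists l : list nat,
       NoDup l /\ (forall k : nat, In k l <-> b k = Some w) /\
       zero_multiplicity f w (length l)).

Definition zeros_summable (b : nat -> option C) (s : nat) : Prop :=
  ex_series (fun k : nat =>
    match b k with Some w => / Cmod w ^ s | None => 0 end).

(* Q is the polynomial Cpoly q d; its degree is d, where a constant Q,
   including Q = 0, is given degree 0. *)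
Definition is_genus (f : C -> C) (g : nat) : Prop :=
  exists (n : nat) (q : nat -> C) (d : nat) (b : nat -> option C) (p : nat),
    (d = O \/ q d <> RtoC 0) /\
    enumerates_nonzero_zeros f b /\
    zeros_summable b (p + 1) /\
    (forall p' : nat, (p' < p)%nat -> ~ zeros_summable b (p' + 1)) /\
    (forall z : C, exists P : C,
       is_infprod (fun k : nat =>
         match b k with
         | Some w => weierstrass_factor (z / w) p
         | None => RtoC 1
         end) P /\
       f z = (z ^ n * Cexp (Cpoly q d z) * P)%C) /\
    g = Nat.max p d.

(* Main.v *)
Require Import Defs.
From Stdlib Require Import Reals Lra Lia List Arith FunctionalExtensionality
  ClassicalEpsilon.
From Coquelicot Require Import Coquelicot.

Open Scope R_scope.

(** All zeros of [f] are positive, so on the circle [|z| = r] every factor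
    [|1 - z / a|] is smallest at [z = r] and largest at [z = - r]. Hence
    [m(r) = |f(r)|] and [M(r) = |f(- r)|] ([min_modulus_linprod],
    [max_modulus_linprod]), and the whole statement concerns [f] on the real
    line.

    The zeros are so sparse that [a (k + 1)] outgrows every fixed power of
    [a k], while the multiplicities are as large as order [rho] permits. At
    [3 * a k] the zeros up to [a k] contribute at least [2 ^ m k] to [|f|], the
    later ones at least [1/2], and [2 ^ m k >= 6 * a (k + 1)]. So
    [x => |f(x)|] takes the value [0] at [a k] and a value at least
    [3 * a (k + 1)] at [3 * a k]; by the intermediate value theorem the image
    of [[a k, 3 * a k]] covers [[a (k + 1), 3 * a (k + 1)]]. Pulling back along
    this chain of intervals and using compactness gives a starting point whose
    [n]-th iterate is at least [a n] for every [n] ([forward_orbit],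
    [escaping_orbit]).

    For the order, [ln (1 + x) <= x ^ rho / rho] bounds [ln M(r)] by a constant
    times [r ^ rho], because the sum of [m k / a k ^ rho] is finite; and
    [M(a k) >= 2 ^ m k] gives the lower bound, because [m k] eventually
    exceeds a large multiple of [a k ^ (rho - eps)] for every [eps > 0]. The
    properties of the two sequences that these arguments use are collected in
    [lacunary], and [tower_lacunary] exhibits explicit sequences with all of
    them.

    Genus and multiplicities concern the sequence of zeros with repetitions,
    the grouped product the sequence [a]. Both products have the same limit,
    since the grouped partial products are among the partial products with
    repetitions ([Cprod_block]). Holomorphy of the limit comes from a
    second-order expansion of the partial products with a remainder bounded
    uniformly in the number of factors ([linprod_expansion]). *)

(** * Limits of complex sequences *)

(** Convergence measured by [Cmod], which keeps real limit theorems and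
    triangle inequalities at hand; [Clim_filterlim] returns to the filter form. *)
Definition Clim (u : nat -> C) (l : C) : Prop :=
  is_lim_seq (fun n => Cmod (u n - l)) 0.

Lemma is_lim_seq_0_le (u v : nat -> R) :
  (forall n, 0 <= u n <= v n) -> is_lim_seq v 0 -> is_lim_seq u 0.
Proof.
  intros H Hv. apply is_lim_seq_le_le with (fun _ => 0) v; auto.
  apply is_lim_seq_const.
Qed.

Lemma Clim_filterlim (u : nat -> C) (l : C) :
  Clim u l -> filterlim u eventually (locally l).
Proof.
  intros H. apply filterlim_locally. intros eps.
  apply is_lim_seq_spec in H. destruct (H eps) as [N HN]. exists N. intros n Hn.
  apply C_NormedModule_mixin_compat1. specialize (HN n Hn).
  rewrite Rminus_0_r, Rabs_pos_eq in HN by apply Cmod_ge_0. exact HN.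
Qed.

Lemma Clim_ext (u v : nat -> C) (l : C) :
  (forall n, u n = v n) -> Clim u l -> Clim v l.
Proof.
  intros E. apply is_lim_seq_ext. intros n. now rewrite E.
Qed.

Lemma Clim_plus (u v : nat -> C) (l k : C) :
  Clim u l -> Clim v k -> Clim (fun n => (u n + v n)%C) (l + k)%C.
Proof.
  intros Hu Hv.
  apply is_lim_seq_0_le with (fun n => Cmod (u n - l) + Cmod (v n - k)).
  - intros n. split; [apply Cmod_ge_0|].
    replace (u n + v n - (l + k))%C with ((u n - l) + (v n - k))%C by ring.
    apply Cmod_triangle.
  - replace (Finite 0) with (Finite (0 + 0)) by (f_equal; ring).
    now apply is_lim_seq_plus'.
Qed.

Lemma Clim_scal (c : C) (u : nat -> C) (l : C) :
  Clim u l -> Clim (fun n => (c * u n)%C) (c * l)%C.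
Proof.
  intros Hu. apply is_lim_seq_ext with (fun n => Cmod c * Cmod (u n - l)).
  - intros n. rewrite <- Cmod_mult. f_equal. ring.
  - replace (Finite 0) with (Rbar_mult (Cmod c) 0) by (simpl; f_equal; ring).
    now apply is_lim_seq_scal_l.
Qed.

Lemma Clim_subseq (u : nat -> C) (l : C) (phi : nat -> nat) :
  (forall n, (n <= phi n)%nat) -> Clim u l -> Clim (fun n => u (phi n)) l.
Proof.
  intros Hphi. apply (is_lim_seq_subseq (fun n => Cmod (u n - l))).
  intros P [N HN]. exists N. intros n Hn. apply HN. specialize (Hphi n). lia.
Qed.

Lemma Clim_shift (u : nat -> C) (l : C) (N : nat) :
  Clim (fun n => u (n + N)%nat) l -> Clim u l.
Proof. apply (is_lim_seq_incr_n (fun n => Cmod (u n - l)) N). Qed.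

Lemma Clim_unique (u : nat -> C) (l k : C) : Clim u l -> Clim u k -> l = k.
Proof.
  intros Hl Hk.
  assert (H : Clim (fun n => (u n + (-(1)) * u n)%C) (l + (-(1)) * k)%C)
    by now apply Clim_plus; [|apply Clim_scal].
  unfold Clim in H.
  apply is_lim_seq_ext with (v := fun _ => Cmod (l - k)) in H.
  2:{ intros n. rewrite <- (Cmod_opp (l - k)). f_equal. ring. }
  assert (E := is_lim_seq_unique _ _ H). rewrite Lim_seq_const in E.
  injection E as E. apply Cmod_eq_0 in E.
  replace l with ((l - k) + k)%C by ring. rewrite E. ring.
Qed.

Lemma Clim_Cmod (u : nat -> C) (l : C) :
  Clim u l -> is_lim_seq (fun n => Cmod (u n)) (Cmod l).
Proof.
  intros H.
  assert (H' : is_lim_seq (fun n => Cmod (u n) - Cmod l) 0).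
  { apply is_lim_seq_abs_0. refine (is_lim_seq_0_le _ _ _ H).
    intros n. split; [apply Rabs_pos|].
    assert (T1 := Cmod_triangle (u n - l) l).
    assert (T2 := Cmod_triangle (l - u n) (u n)).
    replace (u n - l + l)%C with (u n) in T1 by ring.
    replace (l - u n + u n)%C with l in T2 by ring.
    rewrite <- (Cmod_opp (l - u n)) in T2.
    replace (- (l - u n))%C with (u n - l)%C in T2 by ring.
    apply Rabs_le. lra. }
  apply is_lim_seq_ext with (fun n => (Cmod (u n) - Cmod l) + Cmod l).
  - intros n. ring.
  - replace (Finite (Cmod l)) with (Finite (0 + Cmod l)) by (f_equal; ring).
    apply is_lim_seq_plus'; [exact H'|apply is_lim_seq_const].
Qed.

Lemma Clim_Cmod_le (u v : nat -> C) (l k : C) :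
  (forall n, Cmod (u n) <= Cmod (v n)) -> Clim u l -> Clim v k ->
  Cmod l <= Cmod k.
Proof.
  intros H Hu Hv. apply (is_lim_seq_le _ _ (Cmod l) (Cmod k) H);
  now apply Clim_Cmod.
Qed.

Lemma Clim_Cmod_le_const (u : nat -> C) (l : C) (B : R) :
  (exists N, forall n, (N <= n)%nat -> Cmod (u n) <= B) -> Clim u l -> Cmod l <= B.
Proof.
  intros H Hu.
  apply (is_lim_seq_le_loc (fun n => Cmod (u n)) (fun _ => B) (Cmod l) B).
  - exact H.
  - now apply Clim_Cmod.
  - apply is_lim_seq_const.
Qed.

Lemma Clim_Cmod_ge_const (u : nat -> C) (l : C) (B : R) :
  (exists N, forall n, (N <= n)%nat -> B <= Cmod (u n)) -> Clim u l -> B <= Cmod l.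
Proof.
  intros H Hu.
  apply (is_lim_seq_le_loc (fun _ => B) (fun n => Cmod (u n)) B (Cmod l)).
  - exact H.
  - apply is_lim_seq_const.
  - now apply Clim_Cmod.
Qed.

(** * Summable sequences of real numbers *)

(** Sum of the first [n] terms; unlike [sum_n], the sum is empty for [n = 0],
    in step with [Cprod]. *)
Fixpoint psum (x : nat -> R) (n : nat) : R :=
  match n with O => 0 | S n => psum x n + x n end.

Lemma psum_S_sum_n (x : nat -> R) (n : nat) : psum x (S n) = sum_n x n.
Proof.
  induction n as [|n IH].
  - rewrite sum_O. simpl. ring.
  - rewrite sum_Sn, <- IH. reflexivity.
Qed.

Lemma psum_ext (x y : nat -> R) (n : nat) :
  (forall i, x i = y i) -> psum x n = psum y n.
Proof. intros E. induction n; simpl; congruence. Qed.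

Lemma psum_scal (k : R) (x : nat -> R) (n : nat) :
  psum (fun i => k * x i) n = k * psum x n.
Proof. induction n as [|n IH]; simpl; [ring|rewrite IH; ring]. Qed.

Lemma psum_plus_index (x : nat -> R) (p q : nat) :
  psum x (p + q) = psum x p + psum (fun i => x (p + i)%nat) q.
Proof.
  induction q as [|q IH].
  - rewrite Nat.add_0_r. simpl. ring.
  - rewrite Nat.add_succ_r. simpl. rewrite IH. ring.
Qed.

Lemma psum_le (x y : nat -> R) (n : nat) :
  (forall i, x i <= y i) -> psum x n <= psum y n.
Proof.
  intros H. induction n as [|n IH]; simpl; [lra|]. specialize (H n). lra.
Qed.

Lemma psum_ge_0 (x : nat -> R) (n : nat) : (forall i, 0 <= x i) -> 0 <= psum x n.
Proof.
  intros H. induction n as [|n IH]; simpl; [lra|]. specialize (H n). lra.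
Qed.

Lemma psum_mono (x : nat -> R) (n p : nat) :
  (forall i, 0 <= x i) -> (n <= p)%nat -> psum x n <= psum x p.
Proof.
  intros H Hnp. replace p with (n + (p - n))%nat by lia.
  rewrite psum_plus_index.
  assert (0 <= psum (fun i => x (n + i)%nat) (p - n)) by (apply psum_ge_0; auto).
  lra.
Qed.

(** For nonnegative terms bounded partial sums amount to convergence, and they
    pass to subseries and to grouped series by mere comparison. *)
Definition summable (x : nat -> R) : Prop :=
  (forall i, 0 <= x i) /\ exists B, forall n, psum x n <= B.

Lemma summable_ex_series (x : nat -> R) : summable x -> ex_series x.
Proof.
  intros [Hx [B HB]].
  destruct (ex_finite_lim_seq_incr (sum_n x) B) as [l Hl].
  - intros n. rewrite <- !psum_S_sum_n.
    apply psum_mono; [exact Hx|lia].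
  - intros n. now rewrite <- psum_S_sum_n.
  - now exists l.
Qed.

Lemma summable_scal (k : R) (x : nat -> R) :
  0 <= k -> summable x -> summable (fun i => k * x i).
Proof.
  intros Hk [Hx [B HB]]. split.
  - intros i. now apply Rmult_le_pos.
  - exists (k * B). intros n. rewrite psum_scal. now apply Rmult_le_compat_l.
Qed.

Lemma summable_shift (x : nat -> R) (N : nat) :
  summable x -> summable (fun i => x (N + i)%nat).
Proof.
  intros [Hx [B HB]]. split; [now intros i|]. exists B. intros n.
  specialize (HB (N + n)%nat). rewrite psum_plus_index in HB.
  assert (0 <= psum x N) by now apply psum_ge_0. lra.
Qed.

Lemma summable_tail (x : nat -> R) (eps : R) :
  0 < eps -> summable x ->
  exists N, forall n, psum (fun i => x (N + i)%nat) n <= eps.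
Proof.
  intros Heps [Hx [B HB]].
  destruct (ex_finite_lim_seq_incr (psum x) B) as [l Hl]; auto.
  { intros n. apply psum_mono; auto. }
  assert (Hle : forall n, psum x n <= l).
  { intros n. apply (is_lim_seq_incr_compare _ _ Hl). intros k.
    apply psum_mono; auto. }
  apply is_lim_seq_spec in Hl. destruct (Hl (mkposreal eps Heps)) as [N HN].
  exists N. intros n. specialize (HN N (le_n N)). simpl in HN.
  apply Rabs_def2 in HN. specialize (Hle (N + n)%nat).
  rewrite psum_plus_index in Hle. lra.
Qed.

Lemma Clim_of_summable_increments (u : nat -> C) (e : nat -> R) :
  summable e -> (forall n, Cmod (u (S n) - u n) <= e n) ->
  exists l, Clim u l.
Proof.
  intros He Hu.
  destruct (ex_series_le (K := C_AbsRing) (V := C_CompleteNormedModule)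
              (fun n => (u (S n) - u n)%C) e Hu) as [l Hl].
  { now apply summable_ex_series. }
  exists (l + u O)%C. apply Clim_shift with 1%nat.
  assert (Hs : forall n, sum_n (G := C_AbelianMonoid) (fun n => (u (S n) - u n)%C) n
                         = (u (S n) - u O)%C).
  { intros n. induction n as [|n IH].
    - now rewrite sum_O.
    - rewrite sum_Sn, IH.
      change (u (S n) - u O + (u (S (S n)) - u (S n)) = u (S (S n)) - u O)%C.
      ring. }
  unfold Clim. apply is_lim_seq_spec. intros eps.
  assert (Hk : 0 < eps / sqrt 2).
  { apply Rdiv_lt_0_compat; [apply cond_pos|apply Rlt_sqrt2_0]. }
  assert (Hl' := proj1 (filterlim_locally _ _) Hl (mkposreal _ Hk)).
  destruct Hl' as [N HN]. exists N. intros n Hn. specialize (HN n Hn).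
  apply C_NormedModule_mixin_compat2 in HN. simpl in HN.
  rewrite Rminus_0_r, Rabs_pos_eq by apply Cmod_ge_0.
  replace (sqrt 2 * (eps / sqrt 2)) with (pos eps) in HN
    by (field; apply Rgt_not_eq, Rlt_sqrt2_0).
  eapply Rle_lt_trans; [|exact HN]. right. f_equal.
  replace (n + 1)%nat with (S n) by lia.
  etransitivity; [|symmetry; apply (f_equal (fun x => (x - l)%C) (Hs n))]. ring.
Qed.

(** * Infinite products of complex numbers *)

Lemma exp_le (x y : R) : x <= y -> exp x <= exp y.
Proof. intros [L|L]; [left; now apply exp_increasing|right; now rewrite L]. Qed.

Lemma exp_psum_step (x : nat -> R) (n : nat) (A B : R) :
  0 <= A <= exp (psum x n) -> 0 <= B <= 1 + x n -> A * B <= exp (psum x (S n)).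
Proof.
  intros HA HB. simpl. rewrite exp_plus.
  apply Rmult_le_compat; try tauto.
  apply Rle_trans with (1 + x n); [tauto|apply exp_ineq1_le].
Qed.

Lemma Cprod_Cmod_le_exp (u : nat -> C) (x : nat -> R) (n : nat) :
  (forall i, Cmod (u i) <= exp (x i)) -> Cmod (Cprod u n) <= exp (psum x n).
Proof.
  intros H. induction n as [|n IH]; simpl.
  - rewrite Cmod_1, exp_0. lra.
  - rewrite Cmod_mult, exp_plus. apply Rmult_le_compat; auto using Cmod_ge_0.
Qed.

Lemma Cmod_le_exp_sub_1 (w : C) (x : R) : Cmod (w - 1) <= x -> Cmod w <= exp x.
Proof.
  intros H. replace w with (1 + (w - 1))%C by ring.
  eapply Rle_trans; [apply Cmod_triangle|]. rewrite Cmod_1.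
  eapply Rle_trans; [|apply exp_ineq1_le]. lra.
Qed.

(** The Weierstrass inequality: [(1 - s) * (1 - x) >= 1 - s - x] when [s] and
    [x] are nonnegative, and the bound is trivial once it is negative. *)
Lemma Cprod_Cmod_ge (u : nat -> C) (x : nat -> R) (n : nat) :
  (forall i, 0 <= x i) -> (forall i, (i < n)%nat -> 1 - x i <= Cmod (u i)) ->
  1 - psum x n <= Cmod (Cprod u n).
Proof.
  intros Hx H. induction n as [|n IH]; simpl.
  - rewrite Cmod_1. lra.
  - rewrite Cmod_mult.
    assert (IH' : 1 - psum x n <= Cmod (Cprod u n)) by (apply IH; auto).
    assert (P := psum_ge_0 x n Hx). specialize (Hx n). specialize (H n (le_n _)).
    assert (P1 := Cmod_ge_0 (Cprod u n)). assert (P2 := Cmod_ge_0 (u n)).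
    destruct (Rle_lt_dec (1 - psum x n) 0) as [L|L].
    { apply Rle_trans with 0; [lra|now apply Rmult_le_pos]. }
    destruct (Rle_lt_dec (1 - x n) 0) as [L'|L'].
    { apply Rle_trans with 0; [lra|now apply Rmult_le_pos]. }
    apply Rle_trans with ((1 - psum x n) * (1 - x n)); [nra|].
    apply Rmult_le_compat; lra.
Qed.

Lemma Cmod_ge_sub_1 (w : C) (x : R) : Cmod (w - 1) <= x -> 1 - x <= Cmod w.
Proof.
  intros H. assert (T := Cmod_triangle w (- (w - 1))). rewrite Cmod_opp in T.
  replace (w + - (w - 1))%C with (RtoC 1) in T by ring. rewrite Cmod_1 in T. lra.
Qed.

Lemma Cprod_Cmod_mono (u v : nat -> C) (n : nat) :
  (forall i, Cmod (u i) <= Cmod (v i)) -> Cmod (Cprod u n) <= Cmod (Cprod v n).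
Proof.
  intros H. induction n as [|n IH]; simpl; [lra|].
  rewrite !Cmod_mult. apply Rmult_le_compat; auto using Cmod_ge_0.
Qed.

Lemma Cprod_ext (u v : nat -> C) (n : nat) :
  (forall i, u i = v i) -> Cprod u n = Cprod v n.
Proof. intros E. induction n; simpl; congruence. Qed.

Lemma Cprod_plus_index (u : nat -> C) (p q : nat) :
  Cprod u (p + q) = (Cprod u p * Cprod (fun i => u (p + i)%nat) q)%C.
Proof.
  induction q as [|q IH].
  - rewrite Nat.add_0_r. simpl. ring.
  - rewrite Nat.add_succ_r. simpl. rewrite IH. ring.
Qed.

Lemma Cprod_neq_0 (u : nat -> C) (n : nat) :
  (forall i, u i <> RtoC 0) -> Cprod u n <> RtoC 0.
Proof.
  intros H. induction n as [|n IH]; simpl.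
  - intros E. injection E. lra.
  - now apply Cmult_neq_0.
Qed.

(** Partial products stay below [exp (sum of x)], so consecutive ones differ by
    at most a constant times [x n]. *)
Lemma Cprod_cvg (u : nat -> C) (x : nat -> R) :
  summable x -> (forall i, Cmod (u i - 1) <= x i) -> exists l, Clim (Cprod u) l.
Proof.
  intros Hx H. destruct (proj2 Hx) as [B HB].
  apply Clim_of_summable_increments with (fun i => exp B * x i).
  - apply summable_scal; [apply Rlt_le, exp_pos|exact Hx].
  - intros n. simpl.
    replace (Cprod u n * u n - Cprod u n)%C with (Cprod u n * (u n - 1))%C by ring.
    rewrite Cmod_mult. apply Rmult_le_compat; auto using Cmod_ge_0.
    apply Rle_trans with (exp (psum x n)).
    + apply Cprod_Cmod_le_exp. intros i. apply Cmod_le_exp_sub_1, H.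
    + now apply exp_le.
Qed.

(** Once the remaining [x i] add up to at most [1/2], the tail product is at
    least [1/2] in modulus by the Weierstrass inequality, so its limit does not
    vanish. *)
Lemma is_infprod_of_summable (u : nat -> C) (x : nat -> R) (l : C) :
  summable x -> (forall i, Cmod (u i - 1) <= x i) -> Clim (Cprod u) l ->
  is_infprod u l.
Proof.
  intros Hx H Hl.
  destruct (summable_tail x (/ 2)) as [N HN]; [lra|exact Hx|].
  destruct (Cprod_cvg (fun i => u (N + i)%nat) (fun i => x (N + i)%nat)) as [p Hp].
  { now apply summable_shift. }
  { intros i. apply H. }
  exists N, p. repeat split.
  - intros E.
    assert (L : / 2 <= Cmod p).
    { refine (Clim_Cmod_ge_const _ _ _ _ Hp). exists O. intros n _.
      apply Rle_trans with (1 - psum (fun i => x (N + i)%nat) n).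
      - specialize (HN n). lra.
      - apply Cprod_Cmod_ge.
        + intros i. apply (proj1 Hx).
        + intros i _. apply Cmod_ge_sub_1, H. }
    rewrite E, Cmod_0 in L. lra.
  - now apply Clim_filterlim.
  - apply Clim_unique with (Cprod u); [exact Hl|].
    apply Clim_shift with N.
    apply Clim_ext with (fun n => (Cprod u N * Cprod (fun i => u (N + i)%nat) n)%C).
    + intros n. now rewrite Nat.add_comm, Cprod_plus_index.
    + now apply Clim_scal.
Qed.

Lemma is_infprod_neq_0 (u : nat -> C) (l : C) :
  is_infprod u l -> (forall i, u i <> RtoC 0) -> l <> RtoC 0.
Proof.
  intros (N & p & Hp & _ & ->) Hu. apply Cmult_neq_0; [|exact Hp].
  now apply Cprod_neq_0.
Qed.

(** * Products of linear factors *)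

(** Factors are indexed by the inverses [c i] of the zeros; [c i = 0] stands
    for an absent factor, which is how a zero is removed in [drop_zero]. *)
Definition lin (c : nat -> R) (z : C) (i : nat) : C := (1 - c i * z)%C.

Definition linprod (c : nat -> R) (z : C) : C :=
  epsilon (inhabits (RtoC 0)) (Clim (Cprod (lin c z))).

Lemma lin_sub_1 (c : nat -> R) (z : C) (i : nat) :
  0 <= c i -> Cmod (lin c z i - 1) = Cmod z * c i.
Proof.
  intros Hc. unfold lin. replace (1 - c i * z - 1)%C with (- (c i * z))%C by ring.
  rewrite Cmod_opp, Cmod_mult, Cmod_R, Rabs_pos_eq by exact Hc. ring.
Qed.

Lemma linprod_Clim (c : nat -> R) (z : C) :
  summable c -> Clim (Cprod (lin c z)) (linprod c z).
Proof.
  intros Hc. unfold linprod. apply epsilon_spec.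
  apply Cprod_cvg with (fun i => Cmod z * c i).
  - apply summable_scal; [apply Cmod_ge_0|exact Hc].
  - intros i. right. apply lin_sub_1, Hc.
Qed.

Lemma linprod_is_infprod (c : nat -> R) (z : C) :
  summable c -> is_infprod (lin c z) (linprod c z).
Proof.
  intros Hc. apply is_infprod_of_summable with (fun i => Cmod z * c i).
  - apply summable_scal; [apply Cmod_ge_0|exact Hc].
  - intros i. right. apply lin_sub_1, Hc.
  - now apply linprod_Clim.
Qed.

(** Derivative at [z] of the [n]-th partial product, by the product rule. *)
Fixpoint dprod (c : nat -> R) (z : C) (n : nat) : C :=
  match n with
  | O => RtoC 0
  | S n => (dprod c z n * lin c z n - c n * Cprod (lin c z) n)%C
  end.

Lemma Cmod_lin_le (c : nat -> R) (z : C) (i : nat) :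
  0 <= c i -> Cmod (lin c z i) <= 1 + Cmod z * c i.
Proof.
  intros Hc. rewrite <- lin_sub_1 by exact Hc.
  replace (lin c z i) with (1 + (lin c z i - 1))%C at 1 by ring.
  eapply Rle_trans; [apply Cmod_triangle|]. rewrite Cmod_1. lra.
Qed.

Lemma lin_Cprod_le (c : nat -> R) (z : C) (n : nat) :
  (forall i, 0 <= c i) ->
  Cmod (Cprod (lin c z) n) <= exp (psum (fun i => (Cmod z + 2) * c i) n).
Proof.
  intros Hc. apply Cprod_Cmod_le_exp. intros i. apply Cmod_le_exp_sub_1.
  rewrite lin_sub_1 by apply Hc. specialize (Hc i). nra.
Qed.

Lemma dprod_le (c : nat -> R) (z : C) (n : nat) :
  (forall i, 0 <= c i) ->
  Cmod (dprod c z n) <= exp (psum (fun i => (Cmod z + 2) * c i) n).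
Proof.
  intros Hc. induction n as [|n IH].
  - simpl. rewrite Cmod_0, exp_0. lra.
  - apply Rle_trans with
      (exp (psum (fun i => (Cmod z + 2) * c i) n) * (1 + (Cmod z + 1) * c n)).
    + simpl dprod. unfold Cminus at 1.
      eapply Rle_trans; [apply Cmod_triangle|].
      rewrite Cmod_opp, !Cmod_mult, Cmod_R, (Rabs_pos_eq _ (Hc n)).
      assert (L := Cmod_lin_le c z n (Hc n)). assert (P := lin_Cprod_le c z n Hc).
      specialize (Hc n).
      assert (Cmod (dprod c z n) * Cmod (lin c z n)
        <= exp (psum (fun i => (Cmod z + 2) * c i) n) * (1 + Cmod z * c n))
        by (apply Rmult_le_compat; auto using Cmod_ge_0).
      nra.
    + specialize (Hc n). assert (Z := Cmod_ge_0 z).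
      apply exp_psum_step; split; try nra. apply Rlt_le, exp_pos.
Qed.

(** Expanding the partial product at [z + h] in powers of [h], the terms of
    order at least two add up, for [|h| <= 1], to at most [|h| ^ 2] times the
    product of the [1 + (|z| + 2) * c i]; the bound is uniform in [n] for summable [c]. *)
Lemma linprod_remainder_le (c : nat -> R) (z h : C) (n : nat) :
  (forall i, 0 <= c i) -> Cmod h <= 1 ->
  Cmod (Cprod (lin c (z + h)) n - Cprod (lin c z) n - h * dprod c z n)
  <= exp (psum (fun i => (Cmod z + 2) * c i) n) * Cmod h ^ 2.
Proof.
  intros Hc Hh. induction n as [|n IH].
  - simpl Cprod. simpl psum.
    replace (1 - 1 - h * dprod c z 0)%C with (RtoC 0) by (simpl; ring).
    rewrite Cmod_0, exp_0.
    assert (P := pow2_ge_0 (Cmod h)). lra.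
  - set (E := (Cprod (lin c (z + h)) n - Cprod (lin c z) n - h * dprod c z n)%C) in IH.
    simpl Cprod. simpl dprod.
    replace (Cprod (lin c (z + h)) n * lin c (z + h) n
             - Cprod (lin c z) n * lin c z n
             - h * (dprod c z n * lin c z n - c n * Cprod (lin c z) n))%C
      with (E * lin c (z + h) n + - (c n * h ^ 2 * dprod c z n))%C
      by (unfold E, lin; ring).
    eapply Rle_trans; [apply Cmod_triangle|].
    rewrite Cmod_opp, !Cmod_mult, Cmod_pow, Cmod_R, (Rabs_pos_eq _ (Hc n)).
    assert (L := Cmod_lin_le c (z + h) n (Hc n)). assert (P := dprod_le c z n Hc).
    assert (T := Cmod_triangle z h). assert (Q := pow2_ge_0 (Cmod h)).
    set (K := exp (psum _ n)) in *.
    assert (HK : 0 < K) by apply exp_pos. specialize (Hc n).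
    apply Rle_trans with (K * (1 + (Cmod z + 2) * c n) * Cmod h ^ 2).
    + assert (L' : Cmod (lin c (z + h) n) <= 1 + (Cmod z + 1) * c n) by nra.
      assert (Cmod E * Cmod (lin c (z + h) n)
              <= (K * Cmod h ^ 2) * (1 + (Cmod z + 1) * c n))
        by (apply Rmult_le_compat; auto using Cmod_ge_0).
      assert (c n * Cmod h ^ 2 * Cmod (dprod c z n) <= c n * Cmod h ^ 2 * K)
        by (apply Rmult_le_compat_l; [now apply Rmult_le_pos|exact P]).
      nra.
    + apply Rmult_le_compat_r; [exact Q|].
      apply (exp_psum_step (fun i => (Cmod z + 2) * c i)).
      * fold K. lra.
      * split; [|apply Rle_refl]. assert (Z := Cmod_ge_0 z). nra.
Qed.

(** The derivatives [dprod] converge by the same bounds, so the uniform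
    expansion of the partial products passes to the limit. *)
Lemma linprod_expansion (c : nat -> R) (z : C) :
  summable c ->
  exists (d : C) (K : R), 0 <= K /\ forall h : C, Cmod h <= 1 ->
    Cmod (linprod c (z + h) - linprod c z - h * d) <= K * Cmod h ^ 2.
Proof.
  intros Hc.
  assert (Hx : summable (fun i => (Cmod z + 2) * c i)).
  { apply summable_scal; [|exact Hc]. assert (Z := Cmod_ge_0 z). lra. }
  destruct (proj2 Hx) as [B HB].
  assert (HK : forall n, exp (psum (fun i => (Cmod z + 2) * c i) n) <= exp B).
  { intros n. now apply exp_le. }
  destruct (Clim_of_summable_increments (dprod c z)
              (fun i => exp B * ((Cmod z + 2) * c i))) as [d Hd].
  { apply summable_scal; [apply Rlt_le, exp_pos|exact Hx]. }
  { intros n. simpl.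
    replace (dprod c z n * lin c z n - c n * Cprod (lin c z) n - dprod c z n)%C
      with (dprod c z n * (lin c z n - 1) + - (c n * Cprod (lin c z) n))%C by ring.
    eapply Rle_trans; [apply Cmod_triangle|].
    rewrite Cmod_opp, !Cmod_mult, Cmod_R, Rabs_pos_eq, lin_sub_1 by apply Hc.
    assert (P1 := dprod_le c z n (proj1 Hc)).
    assert (P2 := lin_Cprod_le c z n (proj1 Hc)). specialize (HK n).
    assert (Hn := proj1 Hc n). assert (Z := Cmod_ge_0 z). assert (E := exp_pos B).
    assert (Cmod (dprod c z n) * (Cmod z * c n) <= exp B * (Cmod z * c n))
      by (apply Rmult_le_compat_r; [now apply Rmult_le_pos|lra]).
    assert (c n * Cmod (Cprod (lin c z) n) <= c n * exp B)
      by (apply Rmult_le_compat_l; lra).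
    assert (0 <= exp B * c n) by (apply Rmult_le_pos; lra).
    nra. }
  exists d, (exp B). split; [apply Rlt_le, exp_pos|]. intros h Hh.
  assert (HL : Clim (fun n => Cprod (lin c (z + h)) n
                   + ((-(1)) * Cprod (lin c z) n + (- h) * dprod c z n))%C
                (linprod c (z + h) + ((-(1)) * linprod c z + (- h) * d))%C).
  { apply Clim_plus; [now apply linprod_Clim|]. apply Clim_plus.
    - now apply Clim_scal, linprod_Clim.
    - now apply Clim_scal. }
  replace (linprod c (z + h) - linprod c z - h * d)%C
    with (linprod c (z + h) + ((-(1)) * linprod c z + (- h) * d))%C by ring.
  refine (Clim_Cmod_le_const _ _ _ _ HL). exists O. intros n _.
  replace (Cprod (lin c (z + h)) n + (-(1) * Cprod (lin c z) n + - h * dprod c z n))%C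
    with (Cprod (lin c (z + h)) n - Cprod (lin c z) n - h * dprod c z n)%C by ring.
  eapply Rle_trans; [apply linprod_remainder_le; [apply Hc|exact Hh]|].
  apply Rmult_le_compat_r; [apply pow2_ge_0|apply HK].
Qed.

Lemma linprod_entire (c : nat -> R) : summable c -> entire (linprod c).
Proof.
  intros Hc z. destruct (linprod_expansion c z Hc) as (d & K & HK & H).
  exists d. split.
  - apply is_linear_scal_l.
  - intros x Hx. 
    assert (E := is_filter_lim_locally_unique
                   (V := AbsRing_NormedModule C_AbsRing) z x Hx).
    simpl in E. subst x.
    intros eps. apply (locally_le_locally_norm (V := AbsRing_NormedModule C_AbsRing)).
    assert (Hr : 0 < Rmin 1 (eps / (K + 1))).
    { apply Rmin_pos; [lra|]. apply Rdiv_lt_0_compat; [apply cond_pos|lra]. }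
    exists (mkposreal _ Hr).
    change (forall y : C, Cmod (y - z) < Rmin 1 (eps / (K + 1)) ->
              Cmod (linprod c y - linprod c z - (y - z) * d) <= eps * Cmod (y - z)).
    intros y Hy.
    assert (H1 := Rmin_l 1 (eps / (K + 1))). assert (H2 := Rmin_r 1 (eps / (K + 1))).
    specialize (H (y - z)%C). replace (z + (y - z))%C with y in H by ring.
    eapply Rle_trans; [apply H; lra|].
    assert (P := Cmod_ge_0 (y - z)).
    simpl. rewrite Rmult_1_r, <- Rmult_assoc. apply Rmult_le_compat_r; [exact P|].
    apply Rle_trans with ((K + 1) * (eps / (K + 1))); [|right; field; lra].
    apply Rmult_le_compat; lra.
Qed.

(** A first-order expansion implies continuity. *)
Lemma linprod_Cmod_continuity (c : nat -> R) :
  summable c -> continuity (fun x : R => Cmod (linprod c x)).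
Proof.
  intros Hc x. destruct (linprod_expansion c x Hc) as (d & K & HK & H).
  intros eps Heps. set (M := Cmod d + K + 1).
  assert (HM : 0 < M) by (unfold M; assert (P := Cmod_ge_0 d); lra).
  exists (Rmin 1 (eps / M)). split.
  { apply Rmin_pos; [lra|]. now apply Rdiv_lt_0_compat. }
  intros y [_ Hy]. simpl in *. unfold Rdist in *.
  assert (H1 := Rmin_l 1 (eps / M)). assert (H2 := Rmin_r 1 (eps / M)).
  specialize (H (RtoC (y - x))).
  rewrite Cmod_R, <- RtoC_plus in H. replace (x + (y - x)) with y in H by ring.
  specialize (H (Rlt_le _ _ (Rlt_le_trans _ _ _ Hy H1))).
  set (h := RtoC (y - x)) in *. assert (Hh : Cmod h = Rabs (y - x)) by apply Cmod_R.
  assert (HD : Cmod (linprod c y - linprod c x) <= M * Rabs (y - x)).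
  { replace (linprod c y - linprod c x)%C
      with ((linprod c y - linprod c x - h * d) + h * d)%C by ring.
    eapply Rle_trans; [apply Cmod_triangle|]. rewrite Cmod_mult, Hh.
    assert (P := Rabs_pos (y - x)). assert (Rabs (y - x) ^ 2 <= Rabs (y - x)) by nra.
    unfold M. nra. }
  apply Rle_lt_trans with (M * Rabs (y - x)).
  - refine (Rle_trans _ _ _ _ HD).
    assert (T1 := Cmod_triangle (linprod c y - linprod c x) (linprod c x)).
    assert (T2 := Cmod_triangle (- (linprod c y - linprod c x)) (linprod c y)).
    rewrite Cmod_opp in T2.
    replace (linprod c y - linprod c x + linprod c x)%C with (linprod c y) in T1 by ring.
    replace (- (linprod c y - linprod c x) + linprod c y)%C with (linprod c x) in T2 by ring.
    apply Rabs_le. lra.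
  - apply Rlt_le_trans with (M * (eps / M)); [|right; field; lra].
    apply Rmult_lt_compat_l; lra.
Qed.

Lemma entire_scal (k : C) (f : C -> C) : entire f -> entire (fun z => (k * f z)%C).
Proof.
  intros Hf z. destruct (Hf z) as [l Hl]. exists (k * l)%C.
  apply (filterdiff_ext_lin (K := C_AbsRing) (U := AbsRing_NormedModule C_AbsRing)
           (V := C_NormedModule)) with (fun y : C => (k * (y * l))%C).
  - exact (filterdiff_scal_r_fct (K := C_AbsRing) (U := AbsRing_NormedModule C_AbsRing)
             (V := C_NormedModule) k f _ Cmult_comm Hl).
  - intros y. change ((k * (y * l))%C = (y * (k * l))%C). ring.
Qed.

(** * Extreme values on circles *)

Lemma Cmod_1_minus_le (w : C) : Cmod (1 - Cmod w) <= Cmod (1 - w).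
Proof.
  rewrite <- RtoC_minus, Cmod_R.
  assert (T1 := Cmod_triangle (1 - w) w).
  assert (T2 := Cmod_triangle (- (1 - w)) 1). rewrite Cmod_opp in T2.
  replace (1 - w + w)%C with (RtoC 1) in T1 by ring.
  replace (- (1 - w) + 1)%C with w in T2 by ring.
  rewrite Cmod_1 in T1, T2. apply Rabs_le. lra.
Qed.

(** Nonnegative [c] means zeros on the positive axis, the direction in which
    each factor is closest to [0]. *)
Lemma linprod_Cmod_ge (c : nat -> R) (z : C) :
  summable c -> Cmod (linprod c (Cmod z)) <= Cmod (linprod c z).
Proof.
  intros Hc. apply Clim_Cmod_le with (Cprod (lin c (Cmod z))) (Cprod (lin c z));
    try now apply linprod_Clim.
  intros n. apply Cprod_Cmod_mono. intros i. unfold lin.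
  assert (T := Cmod_1_minus_le (c i * z)).
  rewrite Cmod_mult, Cmod_R, Rabs_pos_eq, RtoC_mult in T by apply Hc. exact T.
Qed.

Lemma linprod_Cmod_le (c : nat -> R) (z : C) :
  summable c -> Cmod (linprod c z) <= Cmod (linprod c (- Cmod z)%R).
Proof.
  intros Hc. apply Clim_Cmod_le with (Cprod (lin c z)) (Cprod (lin c (- Cmod z)%R));
    try now apply linprod_Clim.
  intros n. apply Cprod_Cmod_mono. intros i.
  eapply Rle_trans; [apply Cmod_lin_le, Hc|]. right. unfold lin.
  rewrite <- RtoC_mult, <- RtoC_minus, Cmod_R.
  assert (H := Rmult_le_pos _ _ (Cmod_ge_0 z) (proj1 Hc i)).
  rewrite Rabs_pos_eq; lra.
Qed.

Lemma min_modulus_linprod (c : nat -> R) (r : R) :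
  summable c -> 0 <= r -> min_modulus (linprod c) r = Cmod (linprod c r).
Proof.
  intros Hc Hr. unfold min_modulus.
  rewrite (is_glb_Rbar_unique _ (Cmod (linprod c r))); [reflexivity|]. split.
  - intros x [z [Hz ->]]. simpl. rewrite <- Hz. now apply linprod_Cmod_ge.
  - intros b Hb. apply Hb. exists (RtoC r). split; [|reflexivity].
    rewrite Cmod_R. now apply Rabs_pos_eq.
Qed.

Lemma max_modulus_linprod (c : nat -> R) (r : R) :
  summable c -> 0 <= r -> max_modulus (linprod c) r = Cmod (linprod c (- r)%R).
Proof.
  intros Hc Hr. unfold max_modulus.
  rewrite (is_lub_Rbar_unique _ (Cmod (linprod c (- r)%R))); [reflexivity|]. split.
  - intros x [z [Hz ->]]. simpl. rewrite <- Hz. now apply linprod_Cmod_le.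
  - intros b Hb. apply Hb. exists (RtoC (- r)). split; [|reflexivity].
    rewrite Cmod_R, Rabs_Ropp. now apply Rabs_pos_eq.
Qed.

(** * Grouping repeated zeros *)

Fixpoint offset (m : nat -> nat) (k : nat) : nat :=
  match k with O => O | S k => (offset m k + m k)%nat end.

(** When the value [k] is repeated [m k] times in a row, position [i] lies in
    the block [block m i], and block [k] starts at position [offset m k]. The
    test looks one block ahead; since no block is empty, advancing by one is
    enough. *)
Fixpoint block (m : nat -> nat) (i : nat) : nat :=
  match i with
  | O => O
  | S i => if (S i <? offset m (S (block m i)))%nat then block m i
           else S (block m i)
  end.

Lemma offset_le (m : nat -> nat) (j k : nat) :
  (j <= k)%nat -> (offset m j <= offset m k)%nat.
Proof. induction 1; simpl; lia. Qed.

Lemma offset_ge (m : nat -> nat) (k : nat) :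
  (forall k, (1 <= m k)%nat) -> (k <= offset m k)%nat.
Proof. intros H. induction k as [|k IH]; simpl; [lia|specialize (H k); lia]. Qed.

Lemma block_spec (m : nat -> nat) (i : nat) :
  (forall k, (1 <= m k)%nat) ->
  (offset m (block m i) <= i < offset m (S (block m i)))%nat.
Proof.
  intros H. induction i as [|i IH].
  - simpl. specialize (H O). lia.
  - change (block m (S i)) with
      (if (S i <? offset m (S (block m i)))%nat then block m i else S (block m i)).
    assert (P := H (S (block m i))).
    destruct (Nat.ltb_spec (S i) (offset m (S (block m i)))); simpl in *; lia.
Qed.

Lemma block_eq_iff (m : nat -> nat) (i k : nat) :
  (forall k, (1 <= m k)%nat) ->
  block m i = k <-> (offset m k <= i < offset m k + m k)%nat.
Proof.
  intros H. assert (P := block_spec m i H). split.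
  - intros <-. exact P.
  - intros Q. destruct (Nat.lt_trichotomy (block m i) k) as [L|[L|L]]; auto.
    + assert (T := offset_le m (S (block m i)) k L). lia.
    + assert (T := offset_le m (S k) (block m i) L). simpl in T. lia.
Qed.

Lemma Cprod_const (u : nat -> C) (w : C) (n : nat) :
  (forall i, (i < n)%nat -> u i = w) -> Cprod u n = (w ^ n)%C.
Proof.
  intros H. induction n as [|n IH]; [reflexivity|].
  simpl. rewrite IH, H by auto. ring.
Qed.

Lemma psum_const (x : nat -> R) (w : R) (n : nat) :
  (forall i, (i < n)%nat -> x i = w) -> psum x n = INR n * w.
Proof.
  intros H. induction n as [|n IH]; [simpl; ring|].
  rewrite S_INR. simpl. rewrite IH, H by auto. ring.
Qed.

Lemma Cprod_block (m : nat -> nat) (v : nat -> C) (n : nat) :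
  (forall k, (1 <= m k)%nat) ->
  Cprod (fun i => v (block m i)) (offset m n) = Cprod (fun k => v k ^ m k)%C n.
Proof.
  intros H. induction n as [|n IH]; [reflexivity|]. simpl.
  rewrite Cprod_plus_index, IH. f_equal. apply Cprod_const. intros i Hi.
  f_equal. apply block_eq_iff; [exact H|lia].
Qed.

Lemma psum_block (m : nat -> nat) (x : nat -> R) (n : nat) :
  (forall k, (1 <= m k)%nat) ->
  psum (fun i => x (block m i)) (offset m n) = psum (fun k => INR (m k) * x k) n.
Proof.
  intros H. induction n as [|n IH]; [reflexivity|]. simpl.
  rewrite psum_plus_index, IH. f_equal. apply psum_const. intros i Hi.
  f_equal. apply block_eq_iff; [exact H|lia].
Qed.

Lemma summable_block (m : nat -> nat) (x : nat -> R) :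
  (forall k, (1 <= m k)%nat) -> (forall k, 0 <= x k) ->
  summable (fun k => INR (m k) * x k) -> summable (fun i => x (block m i)).
Proof.
  intros H Hx [_ [B HB]]. split; [now intros i|]. exists B. intros n.
  apply Rle_trans with (psum (fun i => x (block m i)) (offset m n)).
  - apply psum_mono; [now intros i|now apply offset_ge].
  - rewrite psum_block by exact H. apply HB.
Qed.

(** Shows that the differences of the grouped factors from [1] are summable:
    over all zeros the exponents [INR n * Cmod w] have a common bound. *)
Lemma Cpow_1_minus_sub_1 (w : C) (n : nat) :
  Cmod ((1 - w) ^ n - 1) <= INR n * Cmod w * exp (INR n * Cmod w).
Proof.
  assert (W := Cmod_ge_0 w). induction n as [|n IH].
  - simpl. replace (1 - 1)%C with (RtoC 0) by ring. rewrite Cmod_0. lra.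
  - rewrite S_INR, Cpow_S.
    replace ((1 - w) * (1 - w) ^ n - 1)%C
      with (((1 - w) ^ n - 1) + - (w * (1 - w) ^ n))%C by ring.
    eapply Rle_trans; [apply Cmod_triangle|]. rewrite Cmod_opp, Cmod_mult.
    assert (N := pos_INR n).
    assert (P : Cmod ((1 - w) ^ n) <= exp (INR n * Cmod w)).
    { rewrite <- (psum_const (fun _ => Cmod w)) by reflexivity.
      rewrite <- (Cprod_const (fun _ => (1 - w)%C)) by reflexivity.
      apply Cprod_Cmod_le_exp. intros _. apply Cmod_le_exp_sub_1.
      replace (1 - w - 1)%C with (- w)%C by ring. rewrite Cmod_opp. apply Rle_refl. }
    assert (Q : exp (INR n * Cmod w) <= exp ((INR n + 1) * Cmod w))
      by (apply exp_le; nra).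
    assert (0 <= INR n * Cmod w) by now apply Rmult_le_pos.
    assert (INR n * Cmod w * exp (INR n * Cmod w)
            <= INR n * Cmod w * exp ((INR n + 1) * Cmod w))
      by now apply Rmult_le_compat_l.
    assert (Cmod w * Cmod ((1 - w) ^ n) <= Cmod w * exp ((INR n + 1) * Cmod w))
      by (apply Rmult_le_compat_l; lra).
    nra.
Qed.

(** The zeros are [/ al k] with multiplicity [m k], listed with repetitions. *)
Definition mulprod (m : nat -> nat) (al : nat -> R) : C -> C :=
  linprod (fun i => al (block m i)).

Definition admissible (m : nat -> nat) (al : nat -> R) : Prop :=
  (forall k, (1 <= m k)%nat) /\ (forall k, 0 <= al k) /\
  summable (fun k => INR (m k) * al k).

Lemma admissible_block (m : nat -> nat) (al : nat -> R) :
  admissible m al -> summable (fun i => al (block m i)).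
Proof. intros (H & Ha & Hs). now apply summable_block. Qed.

(** The grouped partial products form a subsequence of the partial products
    with repetitions. *)
Lemma mulprod_Clim (m : nat -> nat) (al : nat -> R) (z : C) :
  admissible m al ->
  Clim (Cprod (fun k => (lin al z k ^ m k)%C)) (mulprod m al z).
Proof.
  intros H. assert (Hm := proj1 H).
  apply Clim_ext with (fun n => Cprod (lin (fun i => al (block m i)) z) (offset m n)).
  - intros n. apply (Cprod_block m (lin al z) n Hm).
  - apply Clim_subseq; [intros n; now apply offset_ge|].
    apply linprod_Clim. now apply admissible_block.
Qed.

Lemma mulprod_is_infprod (m : nat -> nat) (al : nat -> R) (z : C) :
  admissible m al -> is_infprod (fun k => (lin al z k ^ m k)%C) (mulprod m al z).
Proof.
  intros H. assert (Ha := proj1 (proj2 H)). assert (Hs := proj2 (proj2 H)).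
  assert (Hz : summable (fun k => Cmod z * (INR (m k) * al k)))
    by (apply summable_scal; [apply Cmod_ge_0|exact Hs]).
  destruct (proj2 Hz) as [B HB].
  assert (Hle : forall k, Cmod z * (INR (m k) * al k) <= B).
  { intros k. specialize (HB (S k)). simpl in HB.
    assert (P := psum_ge_0 _ k (proj1 Hz)). lra. }
  apply is_infprod_of_summable
    with (fun k => exp B * (Cmod z * (INR (m k) * al k))).
  - apply summable_scal; [apply Rlt_le, exp_pos|exact Hz].
  - intros k. eapply Rle_trans; [apply Cpow_1_minus_sub_1|].
    rewrite Cmod_mult, Cmod_R, Rabs_pos_eq by apply Ha.
    replace (INR (m k) * (al k * Cmod z)) with (Cmod z * (INR (m k) * al k)) by ring.
    rewrite Rmult_comm. apply Rmult_le_compat_r; [apply (proj1 Hz)|apply exp_le, Hle].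
  - now apply mulprod_Clim.
Qed.

Lemma Cprod_remove (u : nat -> C) (k n : nat) :
  (k < n)%nat ->
  Cprod u n = (u k * Cprod (fun j => if (j =? k)%nat then RtoC 1 else u j) n)%C.
Proof.
  induction 1 as [|n Hn IH]; simpl.
  - rewrite Nat.eqb_refl.
    replace (Cprod (fun j => if (j =? k)%nat then RtoC 1 else u j) k) with (Cprod u k).
    { ring. }
    assert (G : forall p, (p <= k)%nat -> Cprod u p
              = Cprod (fun j => if (j =? k)%nat then RtoC 1 else u j) p).
    { induction p as [|p IHp]; intros Hp; [reflexivity|]. simpl.
      destruct (Nat.eqb_spec p k); [lia|]. rewrite IHp by lia. reflexivity. }
    now apply G.
  - rewrite IH. destruct (Nat.eqb_spec n k); [lia|]. ring.
Qed.

Definition drop_zero (al : nat -> R) (k j : nat) : R :=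
  if (j =? k)%nat then 0 else al j.

Lemma drop_zero_admissible (m : nat -> nat) (al : nat -> R) (k : nat) :
  admissible m al -> admissible m (drop_zero al k).
Proof.
  intros (Hm & Ha & [Hs [B HB]]).
  assert (Hd : forall j, 0 <= drop_zero al k j <= al j).
  { intros j. unfold drop_zero. specialize (Ha j). destruct (j =? k)%nat; lra. }
  split; [exact Hm|]. split; [intros j; apply Hd|]. split.
  - intros j. apply Rmult_le_pos; [apply pos_INR|apply Hd].
  - exists B. intros n. eapply Rle_trans; [|apply HB]. apply psum_le. intros j.
    apply Rmult_le_compat_l; [apply pos_INR|apply Hd].
Qed.

(** Splitting off one zero exhibits its multiplicity, and isolates the factor
    that dominates lower bounds. *)
Lemma mulprod_drop_zero (m : nat -> nat) (al : nat -> R) (k : nat) (z : C) :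
  admissible m al ->
  mulprod m al z = (lin al z k ^ m k * mulprod m (drop_zero al k) z)%C.
Proof.
  intros H. apply Clim_unique with (Cprod (fun j => (lin al z j ^ m j)%C)).
  - now apply mulprod_Clim.
  - apply Clim_shift with (S k).
    apply Clim_ext with (fun n => (lin al z k ^ m k *
      Cprod (fun j => lin (drop_zero al k) z j ^ m j) (n + S k))%C).
    + intros n. rewrite (Cprod_remove (fun j => (lin al z j ^ m j)%C) k) by lia.
      f_equal. apply Cprod_ext. intros j. unfold lin, drop_zero.
      destruct (j =? k)%nat; [|reflexivity].
      replace (1 - 0 * z)%C with (RtoC 1) by ring. apply Cpow_1_l.
    + apply (Clim_subseq (fun n => (lin al z k ^ m k *
        Cprod (fun j => lin (drop_zero al k) z j ^ m j) n)%C) _ (fun n => (n + S k)%nat)).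
      * intros n. lia.
      * apply Clim_scal, mulprod_Clim. now apply drop_zero_admissible.
Qed.

(** * Orbits along a chain of intervals *)

(** Since [h] maps [[A n, B n]] over [[A (n + 1), B (n + 1)]], any point of the
    last interval can be pulled back one interval at a time. *)
Lemma backward_orbit (h : R -> R) (A B : nat -> R) :
  continuity h -> (forall n, A n <= B n) ->
  (forall n, h (A n) <= A (S n)) -> (forall n, B (S n) <= h (B n)) ->
  forall n y, A n <= y <= B n ->
  exists x, A O <= x <= B O /\ Nat.iter n h x = y /\
    forall j, (j <= n)%nat -> A j <= Nat.iter j h x.
Proof.
  intros Hh HAB HA HB. induction n as [|n IH]; intros y Hy.
  - exists y. repeat split; try apply Hy. intros j Hj.
    replace j with O by lia. apply Hy.
  - destruct (IVT_gen h (A n) (B n) y Hh) as [x [Hx E]].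
    + specialize (HA n). specialize (HB n).
      assert (M1 := Rmin_l (h (A n)) (h (B n))).
      assert (M2 := Rmax_r (h (A n)) (h (B n))). lra.
    + rewrite Rmin_left, Rmax_right in Hx by apply HAB.
      destruct (IH x Hx) as (x0 & H0 & E0 & L0).
      assert (E1 : Nat.iter (S n) h x0 = y) by (simpl; now rewrite E0).
      exists x0. repeat split; try apply H0; [exact E1|]. intros j Hj.
      destruct (Nat.eq_dec j (S n)) as [->|Nj]; [rewrite E1; apply Hy|].
      apply L0. lia.
Qed.

Lemma iter_continuity (h : R -> R) (n : nat) :
  continuity h -> continuity (fun x => Nat.iter n h x).
Proof.
  intros Hh. induction n as [|n IH]; simpl.
  - apply derivable_continuous, derivable_id.
  - exact (continuity_comp _ _ IH Hh).
Qed.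

(** The orbits that follow the first [n] intervals start in the compact interval
    [[A 0, B 0]]; at a cluster point of their starting points all the closed
    conditions [A j <= h^j x] survive. *)
Lemma forward_orbit (h : R -> R) (A B : nat -> R) :
  continuity h -> (forall n, A n <= B n) ->
  (forall n, h (A n) <= A (S n)) -> (forall n, B (S n) <= h (B n)) ->
  exists x, A O <= x /\ forall n, A n <= Nat.iter n h x.
Proof.
  intros Hh HAB HA HB.
  pose (P n x := A O <= x <= B O /\ forall j, (j <= n)%nat -> A j <= Nat.iter j h x).
  assert (E : forall n, exists x, P n x).
  { intros n. destruct (backward_orbit h A B Hh HAB HA HB n (A n)) as (x & H1 & _ & H2).
    { split; [lra|apply HAB]. }
    exists x. now split. }
  pose (x n := epsilon (inhabits 0) (P n)).
  assert (Hx : forall n, P n (x n)) by (intros n; apply epsilon_spec, E).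
  destruct (Bolzano_Weierstrass x (fun y => A O <= y <= B O)) as [l Hl].
  { apply compact_P3. }
  { intros n. apply Hx. }
  assert (L : forall n, A n <= Nat.iter n h l).
  { intros n. apply Rnot_lt_le. intros Hn.
    destruct (iter_continuity h n Hh l (A n - Nat.iter n h l)) as [d [Hd Hc]]; [lra|].
    destruct (Hl (disc l (mkposreal d Hd)) n) as [p [Hp Hdisc]].
    { exists (mkposreal d Hd). intros y Hy. exact Hy. }
    assert (Q := proj2 (Hx p) n Hp).
    destruct (Req_dec (x p) l) as [El|Nl].
    { rewrite El in Q. lra. }
    assert (T := Hc (x p)). simpl in T. unfold Rdist in T.
    assert (T' := T (conj (conj I (not_eq_sym Nl)) Hdisc)).
    apply Rabs_def2 in T'. lra. }
  exists l. split; [exact (L O)|exact L].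
Qed.

(** * Elementary inequalities *)

Lemma ln_le_compat (x y : R) : 0 < x <= y -> ln x <= ln y.
Proof. intros [P [L|L]]; [left; now apply ln_increasing|right; now rewrite L]. Qed.

(** Taking logarithms, [ln (1 + x) <= x ^ rho / rho]. It follows from
    subadditivity, [(1 + x) ^ rho <= 1 + x ^ rho <= exp (x ^ rho)]. *)
Lemma Rpower_1_plus_le (rho x : R) :
  0 < rho <= 1 -> 0 < x -> 1 + x <= exp (Rpower x rho * / rho).
Proof.
  intros Hr Hx.
  (* For [0 < y < 1] the power [y ^ rho] is at least [y]; apply this to the two
     numbers [1 / (1 + x)] and [x / (1 + x)], whose sum is [1]. *)
  assert (Hsub : forall y, 0 < y < 1 -> y <= Rpower y rho).
  { intros y Hy. rewrite <- (Rpower_1 y) at 1 by lra. unfold Rpower.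
    apply exp_le. assert (L : ln y < 0) by (rewrite <- ln_1; apply ln_increasing; lra). nra. }
  assert (H1 : Rpower (1 + x) rho <= 1 + Rpower x rho).
  { assert (P1 : / (1 + x) <= Rpower (/ (1 + x)) rho).
    { apply Hsub. split; [apply Rinv_0_lt_compat; lra|].
      rewrite <- Rinv_1. apply Rinv_lt_contravar; lra. }
    assert (P2 : x * / (1 + x) <= Rpower (x * / (1 + x)) rho).
    { apply Hsub. split; [apply Rmult_lt_0_compat; [lra|apply Rinv_0_lt_compat; lra]|].
      apply Rmult_lt_reg_r with (1 + x); [lra|]. field_simplify; lra. }
    assert (Hi : 0 < / (1 + x)) by (apply Rinv_0_lt_compat; lra).
    rewrite <- Rpower_mult_distr in P2 by lra.
    assert (E : Rpower (1 + x) rho * Rpower (/ (1 + x)) rho = 1).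
    { rewrite Rpower_mult_distr by lra. rewrite Rinv_r by lra.
      unfold Rpower. rewrite ln_1, Rmult_0_r. apply exp_0. }
    assert (S : / (1 + x) + x * / (1 + x) = 1) by (field; lra).
    assert (Q : 0 < Rpower (1 + x) rho) by apply exp_pos.
    assert (1 <= (1 + Rpower x rho) * Rpower (/ (1 + x)) rho) by lra.
    apply Rle_trans with (Rpower (1 + x) rho *
      ((1 + Rpower x rho) * Rpower (/ (1 + x)) rho)); [nra|].
    right. transitivity ((1 + Rpower x rho) *
      (Rpower (1 + x) rho * Rpower (/ (1 + x)) rho)); [ring|rewrite E; ring]. }
  assert (H2 : Rpower (1 + x) rho <= exp (Rpower x rho)).
  { eapply Rle_trans; [exact H1|apply exp_ineq1_le]. }
  assert (H3 : rho * ln (1 + x) <= Rpower x rho).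
  { apply Rnot_lt_le. intros L. unfold Rpower in H2 at 1.
    apply exp_increasing in L. lra. }
  rewrite <- (exp_ln (1 + x)) at 1 by lra. apply exp_le.
  apply Rmult_le_reg_l with rho; [lra|].
  replace (rho * (Rpower x rho * / rho)) with (Rpower x rho) by (field; lra). lra.
Qed.

Lemma Cpoly_bound (c : nat -> C) (d : nat) :
  exists K, 0 <= K /\ forall z, 1 <= Cmod z -> Cmod (Cpoly c d z) <= K * Cmod z ^ d.
Proof.
  unfold Cpoly. induction d as [|d (K & HK & IH)].
  - exists (Cmod (c O)). split; [apply Cmod_ge_0|]. intros z _. rewrite sum_O.
    simpl. rewrite Cmod_mult, Cmod_1. lra.
  - exists (K + Cmod (c (S d))). assert (P := Cmod_ge_0 (c (S d))).
    split; [lra|]. intros z Hz. rewrite sum_Sn.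
    eapply Rle_trans; [apply Cmod_triangle|].
    rewrite Cmod_mult, Cmod_pow, Rmult_plus_distr_r.
    apply Rplus_le_compat_r. eapply Rle_trans; [now apply IH|].
    apply Rmult_le_compat_l; [exact HK|]. apply Rle_pow; [exact Hz|lia].
Qed.

(** * Rapidly growing zeros of large multiplicity *)

(** The upper bound for the order needs [order_summable], its lower bound
    [order_lower]. The other two growth conditions govern [|f|] at [3 * a k]:
    by [tail_small] the zeros beyond [a k] cost at most a factor [1/2], and by
    [jump] the factor [2 ^ m k] earned from the zero [a k] still reaches
    [3 * a (k + 1)] after this loss. *)
Record lacunary (rho : R) (a : nat -> R) (m : nat -> nat) : Prop := {
  mult_pos : forall k, (1 <= m k)%nat;
  zero_ge_1 : forall k, 1 <= a k;
  zero_incr : forall k, a k < a (S k);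
  zero_lim : is_lim_seq a p_infty;
  order_summable : summable (fun k => INR (m k) * / Rpower (a k) rho);
  order_lower : forall eps, 0 < eps -> exists K, forall k, (K <= k)%nat ->
    Rpower (a k) (rho - eps) <= INR (m k) * ln 2;
  tail_small : forall k n,
    psum (fun i => INR (m (S k + i)%nat) * / a (S k + i)%nat) n <= / (6 * a k);
  jump : forall k, 6 * a (S k) <= 2 ^ m k
}.

Definition inv_seq (a : nat -> R) (k : nat) : R := / a k.

Section Lacunary.
Variables (rho : R) (a : nat -> R) (m : nat -> nat).
Hypothesis Hrho : 0 < rho <= 1.
Hypothesis Hlac : lacunary rho a m.
Let f := mulprod m (inv_seq a).

Lemma zero_le (j k : nat) : (j <= k)%nat -> a j <= a k.
Proof.
  induction 1 as [|k _ IH]; [lra|]. assert (L := zero_incr _ _ _ Hlac k). lra.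
Qed.

Lemma zero_inj (j k : nat) : a j = a k -> j = k.
Proof.
  assert (L : forall p q, (p < q)%nat -> a p < a q).
  { intros p q Hpq. eapply Rlt_le_trans; [apply (zero_incr _ _ _ Hlac)|].
    now apply zero_le. }
  intros E. destruct (Nat.lt_trichotomy j k) as [T|[T|T]]; auto;
    apply L in T; lra.
Qed.

Lemma inv_zero_pos (k : nat) : 0 < inv_seq a k.
Proof. apply Rinv_0_lt_compat. assert (Q := zero_ge_1 _ _ _ Hlac k). lra. Qed.

Lemma lacunary_admissible : admissible m (inv_seq a).
Proof.
  assert (Ha : forall k, 0 <= inv_seq a k) by (intros k; apply Rlt_le, inv_zero_pos).
  split; [apply Hlac|]. split; [exact Ha|]. split.
  - intros k. apply Rmult_le_pos; [apply pos_INR|apply Ha].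
  - destruct (order_summable _ _ _ Hlac) as [_ [B HB]]. exists B. intros n.
    eapply Rle_trans; [|apply HB]. apply psum_le. intros k.
    apply Rmult_le_compat_l; [apply pos_INR|]. assert (Q := zero_ge_1 _ _ _ Hlac k).
    apply Rinv_le_contravar; [apply exp_pos|].
    rewrite <- (Rpower_1 (a k)) at 2 by lra. apply Rle_Rpower; lra.
Qed.

(** On the negative axis every factor is at least [1]. *)
Lemma max_modulus_ge (k : nat) (r : R) :
  0 <= r -> (1 + r * / a k) ^ m k <= Cmod (f (- r)%R).
Proof.
  intros Hr. unfold f.
  rewrite (mulprod_drop_zero m _ k) by apply lacunary_admissible.
  assert (P := Rmult_le_pos _ _ Hr (Rlt_le _ _ (inv_zero_pos k))).
  fold (inv_seq a k).
  rewrite Cmod_mult, Cmod_pow. unfold lin at 1.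
  rewrite <- RtoC_mult, <- RtoC_minus, Cmod_R, Rabs_pos_eq by lra.
  replace (1 - inv_seq a k * - r) with (1 + r * inv_seq a k) by ring.
  rewrite <- (Rmult_1_r (_ ^ m k)) at 1. apply Rmult_le_compat_l.
  { apply pow_le. lra. }
  assert (D := drop_zero_admissible _ _ k lacunary_admissible).
  refine (Clim_Cmod_ge_const _ _ _ _ (mulprod_Clim _ _ (- r)%R D)).
  exists O. intros n _.
  apply Rle_trans with (1 - psum (fun _ => 0) n).
  - rewrite (psum_const _ 0) by reflexivity. lra.
  - apply Cprod_Cmod_ge; [intros; lra|]. intros j _. rewrite Cmod_pow, Rminus_0_r.
    apply pow_R1_Rle. unfold lin. rewrite <- RtoC_mult, <- RtoC_minus, Cmod_R.
    assert (P' := Rmult_le_pos _ _ Hr (proj1 (proj2 D) j)).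
    rewrite Rabs_pos_eq; lra.
Qed.

Lemma max_modulus_le (B r : R) :
  (forall n, psum (fun k => INR (m k) * / Rpower (a k) rho) n <= B) ->
  0 < r -> Cmod (f (- r)%R) <= exp (Rpower r rho * / rho * B).
Proof.
  intros HB Hr.
  refine (Clim_Cmod_le_const _ _ _ _ (mulprod_Clim _ _ (- r)%R lacunary_admissible)).
  exists O. intros n _.
  assert (Hk : 0 <= Rpower r rho * / rho).
  { apply Rmult_le_pos; [apply Rlt_le, exp_pos|].
    apply Rlt_le, Rinv_0_lt_compat. lra. }
  apply Rle_trans with (exp (psum (fun k => Rpower r rho * / rho *
                          (INR (m k) * / Rpower (a k) rho)) n)).
  - apply Cprod_Cmod_le_exp. intros k. rewrite Cmod_pow. unfold lin.
    assert (P := Rmult_lt_0_compat _ _ Hr (inv_zero_pos k)).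
    assert (Q := zero_ge_1 _ _ _ Hlac k).
    rewrite <- RtoC_mult, <- RtoC_minus, Cmod_R, Rabs_pos_eq by lra.
    replace (1 - inv_seq a k * - r) with (1 + r * inv_seq a k) by ring.
    apply Rle_trans with (exp (Rpower (r * inv_seq a k) rho * / rho) ^ m k).
    + apply pow_incr. split; [lra|]. apply Rpower_1_plus_le; auto.
    + rewrite <- Rpower_pow by apply exp_pos. unfold Rpower at 1. rewrite ln_exp.
      right. f_equal. rewrite <- Rpower_mult_distr by (auto; apply inv_zero_pos).
      replace (Rpower (inv_seq a k) rho) with (/ Rpower (a k) rho); [ring|].
      unfold Rpower, inv_seq. rewrite ln_Rinv by lra.
      rewrite <- exp_Ropp. f_equal. ring.
  - apply exp_le. rewrite psum_scal. now apply Rmult_le_compat_l.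
Qed.

Lemma max_modulus_lacunary (r : R) : 0 <= r -> max_modulus f r = Cmod (f (- r)%R).
Proof. apply max_modulus_linprod, admissible_block, lacunary_admissible. Qed.

Lemma min_modulus_lacunary (r : R) : 0 <= r -> min_modulus f r = Cmod (f r).
Proof. apply min_modulus_linprod, admissible_block, lacunary_admissible. Qed.

Lemma zero_eventually_gt (A : R) :
  exists K, forall k, (K <= k)%nat -> A < a k.
Proof.
  assert (L := zero_lim _ _ _ Hlac). apply is_lim_seq_spec in L. exact (L A).
Qed.

Lemma lacunary_order : is_order f (Finite rho).
Proof.
  intros eps. assert (Heps := cond_pos eps). split.
  - intros A. destruct (order_lower _ _ _ Hlac (eps / 2)) as [K1 H1]; [lra|].
    destruct (zero_eventually_gt (Rmax A 1)) as [K2 H2].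
    set (k := Nat.max K1 K2). exists (a k).
    specialize (H1 k (Nat.le_max_l _ _)). specialize (H2 k (Nat.le_max_r _ _)).
    assert (M1 := Rmax_l A 1). assert (M2 := Rmax_r A 1).
    split; [lra|]. rewrite max_modulus_lacunary by lra.
    assert (G := max_modulus_ge k (a k)).
    replace (1 + a k * / a k) with 2 in G by (field; lra).
    assert (La : 0 < ln (a k)) by (rewrite <- ln_1; apply ln_increasing; lra).
    assert (P : 0 < Rpower (a k) (rho - eps / 2)) by apply exp_pos.
    assert (L1 : INR (m k) * ln 2 <= ln (Cmod (f (- a k)%R))).
    { rewrite <- ln_pow by lra. apply ln_le_compat. split; [apply pow_lt; lra|].
      apply G. lra. }
    assert (L2 : (rho - eps / 2) * ln (a k) <= ln (ln (Cmod (f (- a k)%R)))).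
    { rewrite <- ln_Rpower. apply ln_le_compat. lra. }
    apply Rmult_lt_reg_r with (ln (a k)); [exact La|].
    unfold Rdiv at 1. rewrite Rmult_assoc, Rinv_l by lra. nra.
  - destruct (order_summable _ _ _ Hlac) as [_ [B HB]].
    set (B' := Rmax B 1).
    assert (HB' : forall n, psum (fun k => INR (m k) * / Rpower (a k) rho) n <= B').
    { intros n. eapply Rle_trans; [apply HB|apply Rmax_l]. }
    assert (PB : 1 <= B') by apply Rmax_r.
    assert (PK : 0 < / rho * B').
    { apply Rmult_lt_0_compat; [apply Rinv_0_lt_compat|]; lra. }
    (* [ln r >= Q] makes the constant [ln (B' / rho)] smaller than [eps * ln r]. *)
    set (Q := Rabs (ln (/ rho * B')) / eps + 1).
    assert (HQ : 0 < Q).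
    { assert (0 <= Rabs (ln (/ rho * B')) / eps); [|unfold Q; lra].
      apply Rmult_le_pos; [apply Rabs_pos|]. apply Rlt_le, Rinv_0_lt_compat. lra. }
    exists (exp Q). intros r Hr.
    assert (Pr : 0 < r) by (eapply Rlt_le_trans; [apply exp_pos|exact Hr]).
    assert (Lr : Q <= ln r).
    { rewrite <- (ln_exp Q). apply ln_le_compat. split; [apply exp_pos|exact Hr]. }
    rewrite max_modulus_lacunary by lra.
    assert (U := max_modulus_le B' r HB' Pr).
    assert (V := max_modulus_ge O r (Rlt_le _ _ Pr)).
    assert (V' : 1 < Cmod (f (- r)%R)).
    { eapply Rlt_le_trans; [|exact V].
      assert (P := Rmult_lt_0_compat _ _ Pr (inv_zero_pos O)). unfold inv_seq in P.
      apply Rlt_pow_R1; [lra|]. assert (M := mult_pos _ _ _ Hlac O). lia. }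
    assert (W : 0 < ln (Cmod (f (- r)%R)) <= Rpower r rho * (/ rho * B')).
    { split; [rewrite <- ln_1; apply ln_increasing; lra|].
      rewrite <- Rmult_assoc, <- (ln_exp (_ * B')). apply ln_le_compat. lra. }
    apply ln_le_compat in W.
    rewrite ln_mult, ln_Rpower in W by (auto; apply exp_pos).
    apply Rmult_lt_reg_r with (ln r); [lra|].
    unfold Rdiv at 1. rewrite Rmult_assoc, Rinv_l by lra.
    assert (T : ln (/ rho * B') < eps * Q).
    { unfold Q. rewrite Rmult_plus_distr_l.
      replace (eps * (Rabs (ln (/ rho * B')) / eps)) with (Rabs (ln (/ rho * B')))
        by (field; lra).
      assert (A := Rle_abs (ln (/ rho * B'))). lra. }
    nra.
Qed.

Lemma value_at_zero (k : nat) : f (a k) = RtoC 0.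
Proof.
  unfold f. rewrite (mulprod_drop_zero m _ k) by apply lacunary_admissible.
  assert (Q := zero_ge_1 _ _ _ Hlac k). unfold lin, inv_seq at 1.
  rewrite <- RtoC_mult, Rinv_l by lra.
  assert (M := mult_pos _ _ _ Hlac k). destruct (m k) as [|p]; [lia|].
  simpl. ring.
Qed.

(** The zeros before [a k] contribute at least [1] each, [a k] itself exactly
    [2 ^ m k], and the later ones at least [1/2] by the Weierstrass inequality. *)
Lemma value_at_triple_zero (k : nat) : 3 * a (S k) <= Cmod (f (3 * a k)%R).
Proof.
  assert (Q := zero_ge_1 _ _ _ Hlac k).
  refine (Clim_Cmod_ge_const _ _ _ _ (mulprod_Clim _ _ (3 * a k)%R lacunary_admissible)).
  exists (S k). intros n Hn. replace n with (S k + (n - S k))%nat by lia.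
  rewrite Cprod_plus_index, Cmod_mult.
  set (u := fun j => (lin (inv_seq a) (3 * a k)%R j ^ m j)%C).
  assert (F : forall j, (j <= k)%nat -> 2 <= Cmod (lin (inv_seq a) (3 * a k)%R j)).
  { intros j Hj. unfold lin. rewrite <- RtoC_mult, <- RtoC_minus, Cmod_R, Rabs_minus_sym.
    assert (L := zero_le j k Hj). assert (P := zero_ge_1 _ _ _ Hlac j).
    assert (1 <= inv_seq a j * a k).
    { unfold inv_seq. apply Rmult_le_reg_l with (a j); [lra|].
      rewrite <- Rmult_assoc, Rinv_r by lra. lra. }
    rewrite Rabs_pos_eq; lra. }
  assert (P1 : 2 ^ m k <= Cmod (Cprod u (S k))).
  { simpl. rewrite Cmod_mult, <- (Rmult_1_l (2 ^ m k)).
    apply Rmult_le_compat; [lra|apply pow_le; lra| |].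
    - replace 1 with (1 - psum (fun _ => 0) k)
        by (rewrite (psum_const _ 0) by reflexivity; ring).
      apply Cprod_Cmod_ge; [intros; lra|]. intros j Hj.
      unfold u. rewrite Cmod_pow, Rminus_0_r. apply pow_R1_Rle.
      specialize (F j). apply Rle_trans with 2; [lra|]. apply F. lia.
    - unfold u. rewrite Cmod_pow. apply pow_incr. split; [lra|]. now apply F. }
  assert (P2 : / 2 <= Cmod (Cprod (fun i => u (S k + i)%nat) (n - S k))).
  { set (x := fun i => 3 * a k * (INR (m (S k + i)%nat) * / a (S k + i)%nat)).
    apply Rle_trans with (1 - psum x (n - S k)).
    - unfold x. rewrite psum_scal.
      assert (T := tail_small _ _ _ Hlac k (n - S k)).
      apply (Rmult_le_compat_l (3 * a k)) in T; [|lra].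
      replace (3 * a k * / (6 * a k)) with (/ 2) in T by (field; lra). lra.
    - assert (Hx : forall i, 0 <= x i).
      { intros i. apply Rmult_le_pos; [lra|]. apply Rmult_le_pos; [apply pos_INR|].
        apply Rlt_le, inv_zero_pos. }
      apply Cprod_Cmod_ge; [exact Hx|]. intros i _. unfold u.
      set (j := (S k + i)%nat). set (w := lin (inv_seq a) (3 * a k)%R j).
      assert (Pj := inv_zero_pos j).
      assert (Hw : 0 <= 3 * a k * inv_seq a j) by (apply Rmult_le_pos; lra).
      rewrite <- (Cprod_const (fun _ => w)) by reflexivity.
      replace (x i) with (psum (fun _ => 3 * a k * inv_seq a j) (m j)).
      2:{ rewrite (psum_const _ (3 * a k * inv_seq a j)) by reflexivity.
          unfold x, inv_seq, j. ring. }
      apply Cprod_Cmod_ge; [auto|]. intros p _. apply Cmod_ge_sub_1.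
      unfold w. rewrite lin_sub_1 by lra. rewrite Cmod_R, Rabs_pos_eq; lra. }
  assert (J := jump _ _ _ Hlac k).
  apply Rle_trans with (2 ^ m k * / 2); [lra|].
  apply Rmult_le_compat; [apply pow_le; lra|lra|exact P1|exact P2].
Qed.

(** The intervals of the chain are [[a n, 3 * a n]]; the lower end is mapped to
    [0], below the next interval, and the upper end beyond it. *)
Lemma escaping_orbit :
  exists r : R, 0 < r /\
    is_lim_seq (fun n : nat => Nat.iter n (min_modulus f) r) p_infty.
Proof.
  destruct (forward_orbit (fun x => Cmod (f x)) a (fun k => 3 * a k)) as (r & Hr & L).
  - apply linprod_Cmod_continuity, admissible_block, lacunary_admissible.
  - intros n. assert (Q := zero_ge_1 _ _ _ Hlac n). lra.
  - intros n. assert (Q := zero_ge_1 _ _ _ Hlac (S n)). rewrite value_at_zero, Cmod_0. lra.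
  - apply value_at_triple_zero.
  - assert (P := zero_ge_1 _ _ _ Hlac O). exists r. split; [lra|].
    apply is_lim_seq_le_p_loc with a; [|apply Hlac]. exists O. intros n _.
    eapply Rle_trans; [apply L|]. right. clear L.
    induction n as [|n IH]; [reflexivity|]. simpl. rewrite <- IH.
    symmetry. apply min_modulus_lacunary. destruct n; simpl; [lra|apply Cmod_ge_0].
Qed.

(** A polynomial of degree [d] cannot dominate [(1 + r / a k) ^ m k] when
    [m k > d]. *)
Lemma lacunary_transcendental : transcendental_entire f.
Proof.
  split; [apply linprod_entire, admissible_block, lacunary_admissible|].
  intros (c & d & E). destruct (Cpoly_bound c d) as (K & HK & HP).
  destruct (zero_eventually_gt (2 ^ d)) as [k Hk].
  specialize (Hk (S k)).
  assert (Hd : (S d <= m k)%nat).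
  { destruct (le_lt_dec (S d) (m k)) as [L|L]; [exact L|].
    assert (J := jump _ _ _ Hlac k).
    assert (T := Rle_pow 2 (m k) d ltac:(lra) ltac:(lia)).
    assert (Q := zero_ge_1 _ _ _ Hlac (S k)). specialize (Hk ltac:(lia)). lra. }
  assert (Q := zero_ge_1 _ _ _ Hlac k).
  set (A := a k ^ S d). assert (PA : 0 < A) by (apply pow_lt; lra).
  (* At this [r] the bounds [(r / a k) ^ (d + 1) <= M(r) <= K * r ^ d], which
     force [r <= K * A], are violated. *)
  set (r := K * A + 1). assert (Pr : 1 <= r) by (unfold r; nra).
  assert (G := max_modulus_ge k r ltac:(lra)).
  specialize (HP (RtoC (- r))). rewrite E in G.
  rewrite Cmod_R, Rabs_Ropp, Rabs_pos_eq in HP by lra. specialize (HP Pr).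
  assert (Hq : 0 < r * / a k) by (apply Rmult_lt_0_compat; [lra|apply inv_zero_pos]).
  assert (G1 : (r * / a k) ^ S d <= (1 + r * / a k) ^ m k).
  { apply Rle_trans with ((1 + r * / a k) ^ S d).
    - apply pow_incr. lra.
    - apply Rle_pow; [lra|exact Hd]. }
  rewrite Rpow_mult_distr, pow_inv in G1. fold A in G1.
  assert (G2 : r ^ S d * / A <= K * r ^ d) by lra.
  apply (Rmult_le_compat_r A) in G2; [|lra].
  rewrite Rmult_assoc, Rinv_l, Rmult_1_r in G2 by lra. simpl in G2.
  assert (Pd : 0 < r ^ d) by (apply pow_lt; lra).
  assert (r <= K * A).
  { apply Rmult_le_reg_r with (r ^ d); [exact Pd|]. nra. }
  unfold r in *. lra.
Qed.

Lemma lacunary_genus : is_genus f 0.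
Proof.
  assert (Hm := mult_pos _ _ _ Hlac).
  assert (Adm := lacunary_admissible). assert (Hs := admissible_block _ _ Adm).
  assert (Cexp0 : Cexp 0 = RtoC 1).
  { unfold Cexp. simpl. rewrite exp_0, cos_0, sin_0. unfold RtoC. f_equal; ring. }
  exists O, (fun _ => RtoC 0), O, (fun i => Some (RtoC (a (block m i)))), O.
  split; [now left|]. split; [|split; [|split; [|split]]].
  - split.
    + intros k E. injection E as E. assert (Q := zero_ge_1 _ _ _ Hlac (block m k)). lra.
    + intros w Hw. destruct (excluded_middle_informative (exists k, w = RtoC (a k)))
        as [[k ->]|N].
      (* The zero [a k] occupies exactly the positions of block [k]. *)
      * exists (seq (offset m k) (m k)). split; [apply seq_NoDup|]. split.
        { intros i. rewrite in_seq, <- (block_eq_iff m i k Hm). split.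
          - now intros ->.
          - intros E. injection E as E. now apply zero_inj. }
        rewrite length_seq.
        assert (D := drop_zero_admissible _ _ k Adm).
        assert (Q := zero_ge_1 _ _ _ Hlac k).
        exists (fun z => ((- / RtoC (a k)) ^ m k * mulprod m (drop_zero (inv_seq a) k) z)%C).
        split; [|split].
        { apply entire_scal, linprod_entire, admissible_block, D. }
        { apply Cmult_neq_0.
          - apply Cpow_nz. rewrite <- RtoC_inv, <- RtoC_opp by lra.
            intros E. injection E as E. assert (P := inv_zero_pos k). unfold inv_seq in P. lra.
          - refine (is_infprod_neq_0 _ _ (mulprod_is_infprod _ _ _ D) _).
            intros j. apply Cpow_nz. unfold lin, drop_zero.
            destruct (Nat.eqb_spec j k) as [->|Nj]; intros E.
            + apply (f_equal fst) in E. simpl in E. lra.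
            + rewrite <- RtoC_mult, <- RtoC_minus in E. injection E as E.
              assert (Pj := zero_ge_1 _ _ _ Hlac j). unfold inv_seq in E.
              apply Nj, zero_inj.
              apply Rmult_eq_reg_l with (/ a j); [|apply Rinv_neq_0_compat; lra].
              rewrite Rinv_l by lra. lra. }
        { intros z. unfold f. rewrite (mulprod_drop_zero m _ k z Adm).
          rewrite Cmult_assoc, <- Cpow_mult_l. f_equal. f_equal. unfold lin, inv_seq.
          rewrite RtoC_inv by lra. field. intros E. injection E as E. lra. }
      * exists nil. split; [constructor|]. split.
        { intros i. split; [intros []|]. intros E. injection E as E.
          apply N. now exists (block m i). }
        exists f. split; [apply linprod_entire, Hs|]. split; [|intros z; simpl; ring].
        refine (is_infprod_neq_0 _ _ (linprod_is_infprod _ _ Hs) _).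
        intros i E. apply N. exists (block m i). unfold lin, inv_seq in E.
        assert (Q := zero_ge_1 _ _ _ Hlac (block m i)). rewrite RtoC_inv in E by lra.
        assert (Na : RtoC (a (block m i)) <> 0) by (intros E'; injection E' as E'; lra).
        transitivity (a (block m i) * (1 - (1 - / a (block m i) * w)))%C.
        { field. exact Na. }
        { rewrite E. ring. }
  - unfold zeros_summable. simpl Nat.add.
    apply ex_series_ext with (fun i => inv_seq a (block m i)).
    + intros i. assert (Q := zero_ge_1 _ _ _ Hlac (block m i)).
      rewrite Cmod_R, Rabs_pos_eq, pow_1 by lra. reflexivity.
    + now apply summable_ex_series.
  - intros p' Hp. lia.
  - intros z. exists (f z). split.
    + assert (E : (fun k => weierstrass_factor (z / RtoC (a (block m k))) 0)
        = lin (fun i => inv_seq a (block m i)) z).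
      { apply functional_extensionality. intros i.
        unfold weierstrass_factor. rewrite sum_n_m_zero by lia.
        change (zero : C) with (RtoC 0). rewrite Cexp0. unfold lin, inv_seq.
        assert (Q := zero_ge_1 _ _ _ Hlac (block m i)).
        rewrite RtoC_inv by lra. unfold Cdiv. ring. }
      rewrite E. now apply linprod_is_infprod.
    + unfold Cpoly. rewrite sum_O. simpl pow.
      replace (0 * z ^ 0)%C with (RtoC 0) by (simpl; ring). rewrite Cexp0.
      simpl. ring.
  - reflexivity.
Qed.
End Lacunary.

(** * Explicit zeros and multiplicities *)

(** The quantity [psum y n + 2 * y n] does not increase with [n]. *)
Lemma psum_geometric_le (y : nat -> R) (n : nat) :
  (forall i, 0 <= y i) -> (forall i, y (S i) <= y i / 2) -> psum y n <= 2 * y O.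
Proof.
  intros Hy Hh. assert (P : psum y n + 2 * y n <= 2 * y O).
  { induction n as [|n IH]; simpl; [lra|]. specialize (Hh n). lra. }
  specialize (Hy n). lra.
Qed.

(** Iterated squaring, [tower N k = N ^ (2 ^ k)]: fast enough for the ratio of
    consecutive terms to grow without bound, slow enough for the next term to
    be small against [2 ^ tower N k]. *)
Fixpoint tower (N k : nat) : nat :=
  match k with O => N | S k => (tower N k * tower N k)%nat end.

Definition tower_mult (N k : nat) : nat := (2 ^ (tower N k * tower N k))%nat.

(** With [s = 1 / rho] this makes [m k / a k ^ rho] equal to [2 ^ (- N * t)] for
    [t = tower N k]: small enough for the sums over later zeros to be negligible,
    while the loss [2 ^ (N * t)] stays below every positive power of
    [m k = 2 ^ (t ^ 2)] for large [k]. *)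
Definition tower_zero (s : R) (N k : nat) : R :=
  Rpower 2 (s * (INR (tower N k) ^ 2 + INR N * INR (tower N k))).

Lemma cube_le_pow2 (q : nat) : (16 <= q)%nat -> (q * q * q <= 2 ^ q)%nat.
Proof.
  induction 1 as [|q Hq IH]; [apply Nat.leb_le; reflexivity|].
  rewrite Nat.pow_succ_r'. nia.
Qed.

Lemma tower_ge (N k : nat) : (4 <= N)%nat -> (N + k <= tower N k)%nat.
Proof. intros HN. induction k as [|k IH]; simpl; [lia|nia]. Qed.

Lemma Rpower_2_le (x y : R) : x <= y -> Rpower 2 x <= Rpower 2 y.
Proof. intros L. apply Rle_Rpower; lra. Qed.

Lemma Rpower_2_gt (x : R) : 0 <= x -> x / 2 < Rpower 2 x.
Proof.
  intros Hx. assert (L := ln_lt_2). unfold Rpower.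
  apply Rlt_le_trans with (1 + x * ln 2); [nra|apply exp_ineq1_le].
Qed.

Lemma tower_mult_INR (N k : nat) :
  INR (tower_mult N k) = Rpower 2 (INR (tower N k) ^ 2).
Proof.
  unfold tower_mult. rewrite pow_INR. change (INR 2) with 2.
  rewrite <- Rpower_pow by lra. rewrite mult_INR. f_equal. ring.
Qed.

Section Tower.
Variables (rho : R) (N : nat).
Hypothesis Hrho : 0 < rho <= 1.
Hypothesis HN : 2 * / rho + 4 <= INR N.

Let s := / rho.
Let T k := INR (tower N k).

Lemma N_ge_4 : (4 <= N)%nat.
Proof.
  apply INR_le. simpl. assert (P := Rinv_0_lt_compat rho ltac:(lra)). lra.
Qed.

Lemma s_ge_1 : 1 <= s.
Proof. unfold s. rewrite <- Rinv_1. apply Rinv_le_contravar; lra. Qed.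

Lemma T_S (k : nat) : T (S k) = T k ^ 2.
Proof. unfold T. simpl tower. rewrite mult_INR. ring. Qed.

Lemma T_ge (k : nat) : INR N + INR k <= T k.
Proof. unfold T. rewrite <- plus_INR. apply le_INR, tower_ge, N_ge_4. Qed.

Lemma T_ge_N (k : nat) : INR N <= T k.
Proof. assert (P := T_ge k). assert (Q := pos_INR k). lra. Qed.

(** In base-two exponents, [16 * a k <= a (k + 1) ^ rho / m (k + 1)]. *)
Lemma exponent_le (k : nat) :
  s * (T k ^ 2 + INR N * T k) + 4 <= INR N * T k ^ 2.
Proof.
  assert (P := T_ge_N k). assert (Q := s_ge_1). fold s in HN.
  assert (INR N * T k <= T k ^ 2) by nra.
  assert (s * (INR N * T k) <= s * T k ^ 2) by (apply Rmult_le_compat_l; lra).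
  assert (16 <= T k ^ 2) by nra. nra.
Qed.

(** In base-two exponents, [8 * a (k + 1)] is at most [2 ^ (tower N k ^ 5)]. *)
Lemma tower_zero_S_exponent (k : nat) :
  3 + s * (T (S k) ^ 2 + INR N * T (S k)) <= T k ^ 5.
Proof.
  assert (P := T_ge_N k). assert (E := exponent_le (S k)). rewrite T_S in *.
  assert (Q := s_ge_1). fold s in HN.
  replace (T k ^ 5) with (T k * (T k ^ 2) ^ 2) by ring.
  assert (INR N * (T k ^ 2) ^ 2 <= T k * (T k ^ 2) ^ 2)
    by (apply Rmult_le_compat_r; [apply pow2_ge_0|exact P]).
  lra.
Qed.

(** The value of [m k / a k ^ rho], as [mult_over_zero_rho] shows. *)
Definition dilution (k : nat) : R := Rpower 2 (- (INR N * T k)).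

Lemma dilution_half (k : nat) : dilution (S k) <= dilution k / 2.
Proof.
  unfold dilution. replace (Rpower 2 (- (INR N * T k)) / 2)
    with (Rpower 2 (- (INR N * T k) + - (1))).
  - apply Rpower_2_le. rewrite T_S. assert (P := T_ge_N k).
    assert (Q := s_ge_1). fold s in HN. nra.
  - rewrite Rpower_plus, (Rpower_Ropp 2 1), Rpower_1 by lra. reflexivity.
Qed.

Lemma dilution_pos (k : nat) : 0 < dilution k.
Proof. apply exp_pos. Qed.

Lemma mult_over_zero_rho (k : nat) :
  INR (tower_mult N k) * / Rpower (tower_zero s N k) rho = dilution k.
Proof.
  rewrite tower_mult_INR. unfold tower_zero, dilution. rewrite Rpower_mult.
  rewrite <- Rpower_Ropp, <- Rpower_plus. f_equal. fold (T k). unfold s. field. lra.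
Qed.

Lemma tower_zero_ge_1 (k : nat) : 1 <= tower_zero s N k.
Proof.
  rewrite <- (Rpower_O 2) by lra. apply Rpower_2_le. fold (T k).
  assert (P := T_ge_N k). assert (Q := s_ge_1). fold s in HN.
  apply Rmult_le_pos; [lra|]. nra.
Qed.

Lemma mult_over_zero_le (k : nat) :
  INR (tower_mult N k) * / tower_zero s N k <= dilution k.
Proof.
  rewrite <- mult_over_zero_rho. apply Rmult_le_compat_l; [apply pos_INR|].
  assert (P := tower_zero_ge_1 k).
  apply Rinv_le_contravar; [apply exp_pos|].
  rewrite <- (Rpower_1 (tower_zero s N k)) at 2 by lra. apply Rle_Rpower; lra.
Qed.

Lemma tower_lacunary : lacunary rho (tower_zero s N) (tower_mult N).
Proof.
  assert (Q := s_ge_1). assert (HN' := HN). fold s in HN'.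
  constructor.
  - intros k. unfold tower_mult. assert (P := Nat.pow_nonzero 2 (tower N k * tower N k)).
    lia.
  - apply tower_zero_ge_1.
  - intros k. apply Rpower_lt; [lra|]. fold (T k) (T (S k)). rewrite T_S.
    assert (P := T_ge_N k). apply Rmult_lt_compat_l; [lra|].
    assert (T k < T k ^ 2) by nra. assert (T k ^ 2 < (T k ^ 2) ^ 2) by nra. nra.
  - apply is_lim_seq_le_p_loc with INR; [|apply is_lim_seq_INR].
    exists O. intros k _. apply Rlt_le. assert (P := T_ge_N k). assert (P' := T_ge k).
    eapply Rle_lt_trans; [|apply Rpower_2_gt]; fold (T k).
    + assert (T k * 4 <= T k ^ 2 + INR N * T k) by nra.
      assert (0 <= INR k) by apply pos_INR. nra.
    + apply Rmult_le_pos; [lra|]. nra.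
  - split.
    + intros k. rewrite mult_over_zero_rho. apply Rlt_le, dilution_pos.
    + exists (2 * dilution O). intros n.
      rewrite (psum_ext _ dilution) by apply mult_over_zero_rho.
      apply psum_geometric_le; [intros i; apply Rlt_le, dilution_pos|apply dilution_half].
  - intros eps Heps.
    (* From here on the loss [N * t + 1] in the exponent is at most
       [eps * s * t ^ 2]. *)
    destruct (INR_unbounded ((INR N + 1) / (eps * s))) as [K HK].
    exists K. intros k Hk. rewrite tower_mult_INR. unfold tower_zero.
    rewrite Rpower_mult. fold (T k).
    assert (L := ln_lt_2). apply Rle_trans with (Rpower 2 (T k ^ 2 + - (1))).
    + apply Rpower_2_le.
      assert (P := T_ge_N k). assert (P' := T_ge k). apply le_INR in Hk.
      assert (Hes : 0 < eps * s) by (apply Rmult_lt_0_compat; lra).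
      assert (X : INR N + 1 <= eps * s * T k).
      { apply Rle_trans with (eps * s * ((INR N + 1) / (eps * s))).
        - right. field. lra.
        - apply Rmult_le_compat_l; lra. }
      replace (s * (T k ^ 2 + INR N * T k) * (rho - eps))
        with (T k ^ 2 + INR N * T k - eps * s * (T k ^ 2 + INR N * T k)).
      2:{ unfold s. field. lra. }
      assert (0 <= eps * s * (INR N * T k)) by (apply Rmult_le_pos; nra).
      nra.
    + rewrite Rpower_plus, (Rpower_Ropp 2 1), Rpower_1 by lra.
      apply Rmult_le_compat_l; [apply Rlt_le, exp_pos|lra].
  - intros k n. apply Rle_trans with (psum (fun i => dilution (S k + i)) n).
    { apply psum_le. intros i. apply mult_over_zero_le. }
    apply Rle_trans with (2 * dilution (S k)).
    { replace (dilution (S k)) with (dilution (S k + 0)) by now rewrite Nat.add_0_r.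
      apply (psum_geometric_le (fun i => dilution (S k + i))).
      - intros i. apply Rlt_le, dilution_pos.
      - intros i. rewrite Nat.add_succ_r. apply dilution_half. }
    assert (P := tower_zero_ge_1 k).
    apply Rmult_le_reg_r with (6 * tower_zero s N k); [lra|].
    rewrite Rinv_l by lra.
    assert (X : dilution (S k) * tower_zero s N k <= / 16).
    { unfold dilution, tower_zero. rewrite <- Rpower_plus.
      replace (/ 16) with (Rpower 2 (- INR 4)).
      2:{ rewrite Rpower_Ropp, Rpower_pow by lra. f_equal. ring. }
      apply Rpower_2_le. fold (T k). rewrite T_S. assert (E := exponent_le k).
      simpl INR. lra. }
    lra.
  - intros k. rewrite <- Rpower_pow by lra.
    apply Rle_trans with (Rpower 2 (INR 3) * tower_zero s N (S k)).
    { rewrite Rpower_pow by lra. assert (P := tower_zero_ge_1 (S k)).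
      apply Rmult_le_compat_r; lra. }
    unfold tower_zero. rewrite <- Rpower_plus. apply Rpower_2_le. fold (T (S k)).
    assert (E := tower_zero_S_exponent k). simpl (INR 3).
    apply Rle_trans with (T k ^ 5); [lra|].
    unfold T. rewrite <- pow_INR. apply le_INR. unfold tower_mult.
    assert (P := tower_ge N k N_ge_4). assert (P4 := N_ge_4).
    set (t := tower N k) in *.
    apply Nat.le_trans with ((t * t) * (t * t) * (t * t))%nat.
    (* [t ^ 5 <= (t * t) ^ 3], and a cube is below an exponential. *)
    + simpl. nia.
    + apply cube_le_pow2. nia.
Qed.
End Tower.

(** * The theorem *)

Theorem theorem5p1 :
  forall rho : R, 0 < rho <= 1 ->
  exists (a : nat -> R) (m : nat -> nat),
    (forall k : nat, 0 < a k) /\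
    (forall k : nat, (1 <= m k)%nat) /\
    exists f : C -> C,
      (forall z : C,
         is_infprod (fun k : nat => ((1 - z / RtoC (a k)) ^ m k)%C) (f z)) /\
      transcendental_entire f /\
      is_order f (Finite rho) /\
      is_genus f 0 /\
      exists r : R, 0 < r /\
        is_lim_seq (fun n : nat => Nat.iter n (min_modulus f) r) p_infty.
Proof.
  intros rho Hrho. destruct (INR_unbounded (2 * / rho + 4)) as [N HN].
  set (a := tower_zero (/ rho) N). set (m := tower_mult N).
  assert (L : lacunary rho a m) by (apply tower_lacunary; lra).
  exists a, m. split.
  { intros k. assert (P := zero_ge_1 _ _ _ L k). lra. }
  split; [apply L|]. exists (mulprod m (inv_seq a)).
  split; [|split; [|split; [|split]]].
  - intros z.
    assert (E : (fun k => (1 - z / RtoC (a k)) ^ m k)%C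
                = (fun k => lin (inv_seq a) z k ^ m k)%C).
    { apply functional_extensionality. intros k.
      assert (P := zero_ge_1 _ _ _ L k). unfold lin, inv_seq.
      rewrite RtoC_inv by lra. unfold Cdiv. now rewrite (Cmult_comm z). }
    rewrite E. apply mulprod_is_infprod. now apply (lacunary_admissible rho).
  - now apply lacunary_transcendental with rho.
  - now apply lacunary_order.
  - now apply lacunary_genus with rho.
  - now apply escaping_orbit with rho.
Qed.
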